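(* (a) There exists a sequence $(\mu_k)$ of probability measures on $\mathbb R$, each a mixture of two Gaussian measures of variance $1$, such that $\delta(\mu_k)\to 0$ and \[ \lim_{k\to\infty}\inf_{m\in\mathbb R}\mathrm W_1(\mu_k,\gamma_{m,1})=+\infty. \] (b) There exist dimensions $n(k)\uparrow+\infty$ and probability measures $\mu_k$ on $\mathbb R^{n(k)}$, each isotropic (mean zero, covariance $\mathrm{Id}_{n(k)}$), such that $\delta(\mu_k)=O(n(k)^{-1/3})$ and \[ \inf_{m\in\mathbb R^{n(k)}}\mathrm W_2(\mu_k,\gamma_{m,\mathrm{Id}})=\Omega(n(k)^{1/6}). \]
   Context: $\gamma_{m,\mathrm{Id}}$ denotes the Gaussian measure on $\mathbb R^n$ with mean $m$ and identity covariance; in dimension one $\gamma_{m,1}$ is the Gaussian with mean $m$ and variance $1$. For $\mu$ with density $f=d\mu/d\gamma$ with respect to the standard Gaussian $\gamma$, $\delta(\mu)=\frac12\int|\nabla\log f|^2d\mu-\int\log f\,d\mu$ is the log-Sobolev deficit. $\mathrm W_p(\mu,\nu)=\inf \mathbb E[|X-Y|^p]^{1/p}$, the infimum over all couplings $(X,Y)$ of $(\mu,\nu)$. *)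

(* Defs.v *)
From HB Require Import structures.
From mathcomp Require Import all_boot all_order all_algebra.
From mathcomp Require Import all_classical all_reals all_analysis.
Set Implicit Arguments.
Unset Strict Implicit.
Unset Printing Implicit Defensive.
Import Order.TTheory GRing.Theory Num.Theory.
Import numFieldNormedType.Exports.
Local Open Scope classical_set_scope.
Local Open Scope ring_scope.

(* Points of R^n are n-tuples of reals; n.-tuple R carries the product
   (Borel) sigma-algebra from MathComp-Analysis (measure_tuple_display). *)

Section Defs.
Context {R : realType}.

Definition tcons (n : nat) (x : R) (t : n.-tuple R) : n.+1.-tuple R :=
  [tuple of x :: t].

(* Lebesgue integral on R^n of a nonnegative function, as the iterated
   integral (Tonelli) against the one-dimensional Lebesgue measure. *)
Fixpoint leb_iint (n : nat) : (n.-tuple R -> \bar R) -> \bar R :=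
  match n return (n.-tuple R -> \bar R) -> \bar R with
  | 0 => fun f => f [tuple]
  | n'.+1 => fun f =>
      (\int[@lebesgue_measure R]_x leb_iint (fun t => f (tcons x t)))%E
  end.

Definition leb_int (n : nat) (f : n.-tuple R -> \bar R) : \bar R :=
  (leb_iint (f ^\+) - leb_iint (f ^\-))%E.

Definition sqnorm (n : nat) (x : n.-tuple R) : R :=
  \sum_(i < n) tnth x i ^+ 2.
Definition edist (n : nat) (x y : n.-tuple R) : R :=
  Num.sqrt (\sum_(i < n) (tnth x i - tnth y i) ^+ 2).

Definition gauss_dens (n : nat) (m x : n.-tuple R) : R :=
  (Num.sqrt (pi *+ 2)) ^- n *
  expR (- (\sum_(i < n) (tnth x i - tnth m i) ^+ 2) / 2).

Definition gaussian (n : nat) (m : n.-tuple R) (A : set (n.-tuple R)) : \bar R :=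
  leb_iint (fun x => (\1_A x * gauss_dens m x)%:E).

Definition origin (n : nat) : n.-tuple R := [tuple (0 : R) | _ < n].

Definition gint (n : nat) (g : n.-tuple R -> \bar R) : \bar R :=
  leb_int (fun x => (g x * (gauss_dens (origin n) x)%:E)%E).

Definition dens_meas (n : nat) (f : n.-tuple R -> R) (A : set (n.-tuple R)) : \bar R :=
  gint (fun x => (\1_A x * f x)%:E).

Definition dens_int (n : nat) (f : n.-tuple R -> R) (g : n.-tuple R -> \bar R) : \bar R :=
  gint (fun x => (g x * (f x)%:E)%E).

Definition tset (n : nat) (x : n.-tuple R) (i : 'I_n) (t : R) : n.-tuple R :=
  [tuple (if j == i then t else tnth x j) | j < n].

Definition partial (n : nat) (i : 'I_n) (g : n.-tuple R -> R) (x : n.-tuple R) : R :=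
  derive1 (fun t => g (tset x i t)) (tnth x i).

(* f is the density dmu/dgamma of a probability measure mu on R^n, regular
   enough for the log-Sobolev deficit to be defined: f is measurable,
   positive, admits all partial derivatives everywhere, and integrates to 1
   against gamma. *)
Definition prob_density (n : nat) (f : n.-tuple R -> R) : Prop :=
  [/\ measurable_fun [set: n.-tuple R] f,
      (forall x, 0 < f x),
      (forall x (i : 'I_n), derivable (fun t => f (tset x i t)) (tnth x i) 1)
    & gint (fun x => (f x)%:E) = 1%E].

Definition lsdeficit (n : nat) (f : n.-tuple R -> R) : \bar R :=
  ((2^-1)%:E * dens_int f (fun x =>
       (\sum_(i < n) partial i (fun y => ln (f y)) x ^+ 2)%:E)
   - dens_int f (fun x => (ln (f x))%:E))%E.

Definition coupling (n : nat) (mu nu : set (n.-tuple R) -> \bar R)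
    (pi : probability (n.-tuple R * n.-tuple R)%type R) : Prop :=
  forall A : set (n.-tuple R), measurable A ->
    pi (fst @^-1` A) = mu A /\ pi (snd @^-1` A) = nu A.

Definition wasserstein (n : nat) (p : R) (mu nu : set (n.-tuple R) -> \bar R) : \bar R :=
  ereal_inf [set ((\int[pi]_z ((edist z.1 z.2) `^ p)%:E) `^ p^-1)%E
            | pi in [set pi | coupling mu nu pi]].

End Defs.

(* Main.v *)
Require Import Defs.
From HB Require Import structures.
From mathcomp Require Import all_boot all_order all_algebra.
From mathcomp Require Import all_classical all_reals all_analysis.
From mathcomp Require Import measurable_realfun normal_distribution.
From mathcomp Require Import ring lra.
Set Implicit Arguments.
Unset Strict Implicit.
Unset Printing Implicit Defensive.
Import Order.TTheory GRing.Theory Num.Theory.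
Import numFieldNormedType.Exports.
Local Open Scope classical_set_scope.
Local Open Scope ring_scope.

(** Let [rho] be the mixture [p N(a, s^2) + (1 - p) N(b, s^2)] with weight [p = r^-2]
    and atoms [a = (1 - p) D], [b = - p D], so that [rho] is centered with variance
    [s^2 + p (1 - p) D^2].  By convexity of the Fisher information and of [t ln t], the
    deficit of [rho] exceeds the average deficit of its two components by at most the
    binary entropy of [p], and by at least minus an overlap term of order
    [D^2 exp (- D^2 / (8 s^2))].  The transport cost is governed by the atoms alone: a
    Gaussian centered at [m] misses one of them by at least [D / 2], so [W_1] to [N(m, 1)]
    is at least [p D / 2 - O(1)] and the squared [W_2] is of order [p D^2].
    Part (a) takes [s = 1], [r = N], [D = N^3].  Part (b) takes the [n]-th tensor power with
    [n = N^6], [r = N^8], [D = N^6] and [s^2 = 1 - p (1 - p) D^2], which makes it isotropic: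
    each coordinate has [1 - s^2 ~ N^-4], deficit [O(N^-8)] and squared transport cost
    of order [N^-4], and all these quantities are additive over coordinates. *)

(** * Integrals on the line and moments of the normal law *)

Section HasIntegral.
Context {R : realType}.
Local Notation mu := (@lebesgue_measure R).

(** Integrability and a finite value are bundled into one relation, so that values add, scale and
    compare as real numbers without side conditions on extended reals. *)
Definition has_integral (h : R -> R) (r : R) :=
  mu.-integrable setT (EFin \o h) /\ (\int[mu]_x (h x)%:E = r%:E)%E.

Lemma has_integral_ext {h} h' {r} r' :
  has_integral h r -> h =1 h' -> r = r' -> has_integral h' r'.
Proof. by move=> hr /funext <- <-. Qed.

Lemma has_integral_measurable h r : has_integral h r -> measurable_fun setT h.
Proof. by case=> /measurable_int /measurable_EFinP. Qed.

Lemma has_integralD f g r s : has_integral f r -> has_integral g s ->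
  has_integral (fun x => f x + g x) (r + s).
Proof.
move=> [fi fr] [gi gs]; split; first exact: (integrableD _ fi gi).
by rewrite EFinD -fr -gs -integralD_EFin.
Qed.

Lemma has_integralZ k f r : has_integral f r ->
  has_integral (fun x => k * f x) (k * r).
Proof.
move=> [fi fr]; split; first exact: (integrableZl _ k fi).
by rewrite EFinM -fr -integralZl.
Qed.

Lemma has_integralB f g r s : has_integral f r -> has_integral g s ->
  has_integral (fun x => f x - g x) (r - s).
Proof.
move=> hf /(has_integralZ (-1)) hg; apply: has_integral_ext (has_integralD hf hg) _ _.
- by move=> x; rewrite mulN1r.
- by rewrite mulN1r.
Qed.

Lemma has_integral_le f g r s : has_integral f r -> has_integral g s ->
  (forall x, f x <= g x) -> r <= s.
Proof.
move=> [fi fr] [gi gs] fg; rewrite -lee_fin -fr -gs.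
by apply: le_integral => // x _; rewrite lee_fin.
Qed.

Lemma has_integral_dominated (f g : R -> R) s : measurable_fun setT f -> has_integral g s ->
  (forall x, `|f x| <= g x) -> exists r, has_integral f r.
Proof.
move=> mf [gi _] fg.
have fi : mu.-integrable setT (EFin \o f).
  apply: le_integrable gi => //; first exact/measurable_EFinP.
  by move=> x _; rewrite lee_fin (le_trans (fg x)) // ler_norm.
exists (fine (\int[mu]_x (f x)%:E)%E); split => //.
by rewrite fineK //; exact: (integrable_fin_num _ fi).
Qed.

(** Since [f - g] is dominated by [h - g], it is integrable, hence so is [f]. This sandwich serves
    the Fisher information and the entropy of a mixture, which are only estimated and not
    computed. *)
Lemma has_integral_between (f g h : R -> R) r s : measurable_fun setT f ->
  has_integral g r -> has_integral h s ->
  (forall x, g x <= f x <= h x) -> exists t, [/\ has_integral f t, r <= t & t <= s].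
Proof.
move=> mf gr hs gfh.
have [d dI] : exists d, has_integral (fun x => f x - g x) d.
  apply: has_integral_dominated (has_integralB hs gr) _.
    by apply: measurable_funB => //; exact: has_integral_measurable gr.
  by move=> x; have /andP[gf fh] := gfh x; rewrite ger0_norm ?subr_ge0// lerB.
have fI := has_integralD gr dI.
exists (r + d); split.
- by apply: has_integral_ext fI _ _ => // x; rewrite addrC subrK.
- by apply: has_integral_le gr fI _ => x; have := gfh x; lra.
- by apply: has_integral_le fI hs _ => x; have := gfh x; lra.
Qed.

End HasIntegral.

Section NormalMoments.
Context {R : realType}.
Implicit Types a s x : R.

Lemma normal_pdf_gt0 a s x : 0 < s -> 0 < normal_pdf a s x.
Proof.
move=> s0; rewrite normal_pdfE ?gt_eqF// mulr_gt0 ?expR_gt0//.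
by rewrite normal_peak_gt0 ?gt_eqF.
Qed.

Lemma normal_pdf_expR a s x : 0 < s ->
  normal_pdf a s x =
  (Num.sqrt (pi *+ 2))^-1 * (s^-1 * expR (- (x - a) ^+ 2 / (2 * s ^+ 2))).
Proof.
move=> s0; rewrite normal_pdfE ?gt_eqF// /normal_peak /normal_fun -mulrnAr.
rewrite sqrtrM ?sqr_ge0// sqrtr_sqr gtr0_norm// invfM [in RHS]mulrCA mulrA.
by rewrite -[s ^+ 2 *+ 2]mulr_natl.
Qed.

(** Any Gaussian density is a reference one times an explicit exponential; all comparisons of
    Gaussians below rest on this formula. *)
Lemma normal_pdf_change b t a s x : 0 < s -> 0 < t ->
  normal_pdf b t x =
  normal_pdf a s x * (s / t * expR ((x - a) ^+ 2 / (2 * s ^+ 2)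
                                    - (x - b) ^+ 2 / (2 * t ^+ 2))).
Proof.
move=> s0 t0; rewrite !normal_pdf_expR// expRD !mulNr.
rewrite (expRN ((x - a) ^+ 2 / _)).
have e0 := expR_gt0 ((x - a) ^+ 2 / (2 * s ^+ 2)).
set c := (Num.sqrt _)^-1; field.
by rewrite !gt_eqF.
Qed.

Lemma has_integral_normal a s : has_integral (normal_pdf a s) 1.
Proof. by split; [exact: integrable_normal_pdf|exact: integral_normal_pdf]. Qed.

(** Domination by a wider Gaussian, of standard deviation [s * sqrt 2]: the ratio of the two
    densities is a multiple of [e^y] with [y = (x - a)^2 / (4 s^2)], and [y <= e^y]. *)
Lemma normal_sq_integrable a s : 0 < s ->
  exists r, has_integral (fun x => (x - a) ^+ 2 * normal_pdf a s x) r.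
Proof.
move=> s0.
have c0 : 0 < Num.sqrt (2:R) by rewrite sqrtr_gt0.
have cE : Num.sqrt (2:R) ^+ 2 = 2 by rewrite sqr_sqrtr.
pose t := s * Num.sqrt 2.
have t0 : 0 < t by rewrite mulr_gt0.
apply: has_integral_dominated (has_integralZ (4 * s ^+ 2 * Num.sqrt 2)
    (has_integral_normal a t)) _.
  apply: measurable_funM; last exact: measurable_normal_pdf.
  by apply: measurable_funX; apply: measurable_funB.
move=> x; rewrite ger0_norm; last by rewrite mulr_ge0 ?normal_pdf_ge0// sqr_ge0.
rewrite (normal_pdf_change a a x s0 t0).
have q0 := normal_pdf_gt0 a x s0.
have -> : (x - a) ^+ 2 / (2 * s ^+ 2) - (x - a) ^+ 2 / (2 * t ^+ 2) =
   (x - a) ^+ 2 / (4 * s ^+ 2).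
  rewrite /t exprMn cE; field; lra.
have -> : s / t = (Num.sqrt 2)^-1 by rewrite /t; field; lra.
set e := expR _; have := expR_ge1Dx ((x - a) ^+ 2 / (4 * s ^+ 2)); rewrite -/e => le.
have -> : 4 * s ^+ 2 * Num.sqrt 2 * (normal_pdf a s x * ((Num.sqrt 2)^-1 * e)) =
  4 * s ^+ 2 * e * normal_pdf a s x by field; lra.
rewrite ler_pM2r//.
have -> : (x - a) ^+ 2 = 4 * s ^+ 2 * ((x - a) ^+ 2 / (4 * s ^+ 2)) by field; lra.
by rewrite ler_pM2l ?mulr_gt0 ?exprn_gt0//; lra.
Qed.

(* Comparing the masses of [N(a, s^2)] and [N(a + m, s^2)] through [1 + y <= e^y]
   gives [h m <= h^2 / 2] for every shift [h], in particular for [h = m]. *)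
Lemma has_integral_normal_centered a s : 0 < s ->
  has_integral (fun x => (x - a) * normal_pdf a s x) 0.
Proof.
move=> s0; have [v vI] := normal_sq_integrable a s0.
have NI := has_integral_normal a s.
have [m mI] : exists m, has_integral (fun x => (x - a) * normal_pdf a s x) m.
  apply: has_integral_dominated (has_integralD NI vI) _.
    apply: measurable_funM; last exact: measurable_normal_pdf.
    exact: measurable_funB.
  move=> x; have q0 := normal_pdf_gt0 a x s0.
  rewrite normrM (gtr0_norm q0) -{2}[normal_pdf a s x]mul1r -mulrDl ler_pM2r//.
  rewrite -[(x - a) ^+ 2](real_normK) ?num_real//; set y := `|_|; nra.
suff : m = 0 by move=> m0; rewrite m0 in mI.
have H : 1 + m ^+ 2 / s ^+ 2 - m ^+ 2 / (2 * s ^+ 2) <= 1.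
  apply: (has_integral_le
    (f := fun x => (1 - m ^+ 2 / (2 * s ^+ 2)) * normal_pdf a s x +
                   m / s ^+ 2 * ((x - a) * normal_pdf a s x))
    (g := normal_pdf (a + m) s)).
  - apply: has_integral_ext (has_integralD (has_integralZ _ NI)
      (has_integralZ _ mI)) _ _; first by [].
    by ring.
  - exact: has_integral_normal.
  - move=> x; rewrite (normal_pdf_change (a + m) a x s0 s0).
    rewrite divff ?gt_eqF// mul1r mulrA -mulrDl mulrC ler_pM2l ?normal_pdf_gt0//.
    apply: le_trans (expR_ge1Dx _); rewrite le_eqVlt; apply/orP; left; apply/eqP.
    field; lra.
have : m ^+ 2 / (2 * s ^+ 2) <= 0.
  suff -> : m ^+ 2 / (2 * s ^+ 2) = m ^+ 2 / s ^+ 2 - m ^+ 2 / (2 * s ^+ 2) by lra.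
  field; lra.
rewrite pmulr_lle0 ?invr_gt0 ?mulr_gt0 ?exprn_gt0//.
by move=> m2; apply/eqP; rewrite -(sqrf_eq0 m) eq_le m2 sqr_ge0.
Qed.

(* Comparing the masses of [N(a, s^2)] and [N(a, (s u)^2)] through [1 + y <= e^y]
   bounds [v / s^2] from both sides; [u = (1 + v / s^2) / 2] forces [u = 1]. *)
Lemma has_integral_normal_variance a s : 0 < s ->
  has_integral (fun x => (x - a) ^+ 2 * normal_pdf a s x) (s ^+ 2).
Proof.
move=> s0; have [v vI] := normal_sq_integrable a s0.
suff -> : s ^+ 2 = v by [].
have NI := has_integral_normal a s.
have v0 : 0 <= v.
  have := has_integral_le (has_integralZ 0 NI) vI.
  rewrite mul0r; apply => x.
  by rewrite mul0r mulr_ge0 ?normal_pdf_ge0// sqr_ge0.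
pose u := (1 + v / s ^+ 2) / 2.
have u0 : 0 < u.
  have : 0 <= v / s ^+ 2 by rewrite divr_ge0 ?sqr_ge0.
  rewrite /u; lra.
have vE : v = (2 * u - 1) * s ^+ 2 by rewrite /u; field; lra.
clearbody u.
have H : u^-1 * (1 + (1 - u ^- 2) / (2 * s ^+ 2) * v) <= 1.
  apply: (has_integral_le
    (f := fun x => u^-1 * (normal_pdf a s x + (1 - u ^- 2) / (2 * s ^+ 2) *
                   ((x - a) ^+ 2 * normal_pdf a s x)))
    (g := normal_pdf a (s * u))).
  - apply: (has_integralZ _); apply: has_integralD => //; exact: (has_integralZ _).
  - exact: has_integral_normal.
  - move=> x; rewrite (normal_pdf_change a a x s0 (mulr_gt0 s0 u0)).
    set e := (X in expR X).
    have -> : s / (s * u) = u^-1 by field; lra.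
    rewrite [leRHS]mulrCA ler_pM2l ?invr_gt0// mulrA.
    rewrite -{1}[normal_pdf a s x]mul1r -mulrDl [leRHS]mulrC ler_pM2r ?normal_pdf_gt0//.
    apply: le_trans (expR_ge1Dx _); rewrite le_eqVlt; apply/orP; left; apply/eqP.
    rewrite /e; field; lra.
suff u1 : u = 1 by rewrite vE u1; ring.
move: H; rewrite vE.
(* After substituting [v = (2 u - 1) s^2], the lower bound on the mass is 1 plus a positive multiple
   of [(u - 1)^2]. *)
have -> : u^-1 * (1 + (1 - u ^- 2) / (2 * s ^+ 2) * ((2 * u - 1) * s ^+ 2)) =
  1 + (u - 1) ^+ 2 / (2 * u ^+ 3) by field; lra.
move=> H; have : (u - 1) ^+ 2 / (2 * u ^+ 3) <= 0 by lra.
rewrite pmulr_lle0 ?invr_gt0 ?mulr_gt0 ?exprn_gt0// => m2.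
by apply/eqP; rewrite -subr_eq0 -sqrf_eq0 eq_le m2 sqr_ge0.
Qed.

End NormalMoments.

(** * Fisher information and entropy of a two-point Gaussian mixture *)

Section Mixture.
Context {R : realType}.
Variables (p a b s : R).
Hypotheses (p0 : 0 < p) (p1 : p < 1) (s0 : 0 < s).

Definition mixture (x : R) := p * normal_pdf a s x + (1 - p) * normal_pdf b s x.

Definition mixture_ratio (x : R) := mixture x / normal_pdf 0 1 x.

(* [shift_score c] is the score of [N(c, s^2)] relative to the standard Gaussian. *)
Definition shift_score (c x : R) := x - (x - c) / s ^+ 2.

(** Average of the two component scores, weighted by the posterior probabilities of the components
    at [x]; it is the logarithmic derivative of [mixture_ratio]. *)
Definition score (x : R) :=
  (p * normal_pdf a s x * shift_score a x +
   (1 - p) * normal_pdf b s x * shift_score b x) / mixture x.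

Lemma mixture_gt0 x : 0 < mixture x.
Proof. by rewrite addr_gt0 ?mulr_gt0 ?subr_gt0 ?normal_pdf_gt0. Qed.

Lemma mixture_ratio_gt0 x : 0 < mixture_ratio x.
Proof. by rewrite divr_gt0 ?mixture_gt0 ?normal_pdf_gt0. Qed.

Lemma measurable_mixture : measurable_fun setT mixture.
Proof.
by apply: measurable_funD; apply: measurable_funM => //;
  exact: measurable_normal_pdf.
Qed.

Lemma is_derive_normal_pdf (c t x : R) : 0 < t ->
  is_derive x 1 (normal_pdf c t) (- ((x - c) / t ^+ 2) * normal_pdf c t x).
Proof.
move=> t0.
have -> : normal_pdf c t = fun x => (Num.sqrt (pi *+ 2))^-1 *
    (t^-1 * expR (- (x - c) ^+ 2 / (2 * t ^+ 2))).
  by apply/funext => y; rewrite normal_pdf_expR.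
have c0 : 0 < Num.sqrt (pi *+ 2 : R) by rewrite sqrtr_gt0 pmulrn_lgt0// pi_gt0.
by apply: is_derive_eq; rewrite /GRing.scale/=; field; rewrite !gt_eqF.
Qed.

Lemma is_derive_mixture (x : R) : is_derive x 1 mixture
  (p * (- ((x - a) / s ^+ 2) * normal_pdf a s x) +
   (1 - p) * (- ((x - b) / s ^+ 2) * normal_pdf b s x)).
Proof.
have da := is_derive_normal_pdf a x s0; have db := is_derive_normal_pdf b x s0.
by apply: is_derive_eq; rewrite /GRing.scale/=; ring.
Qed.

Lemma is_derive_mixture_ratio (x : R) :
  is_derive x 1 mixture_ratio (mixture_ratio x * score x).
Proof.
have q0 : forall y : R, normal_pdf 0 1 y != 0 by move=> y; rewrite gt_eqF ?normal_pdf_gt0.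
have dm := is_derive_mixture x; have d0 := is_derive_normal_pdf 0 x ltr01.
have dV := is_deriveV (q0 x) d0.
have dM : is_derive x 1 mixture_ratio _ := is_deriveM dm dV.
apply: (is_derive_eq dM); rewrite /GRing.scale/= /mixture_ratio /score /shift_score.
have m0 := mixture_gt0 x; rewrite /mixture in m0 *.
by field; rewrite q0 !gt_eqF.
Qed.

Lemma measurable_mixture_ratio : measurable_fun setT mixture_ratio.
Proof.
apply: continuous_measurable_fun => x.
apply: differentiable_continuous; apply/derivable1_diffP.
by have [] := is_derive_mixture_ratio x.
Qed.

Lemma measurable_score : measurable_fun setT score.
Proof.
have mV : measurable_fun setT (fun x => (mixture x)^-1).
  apply: continuous_measurable_fun => x.
  apply: differentiable_continuous; apply/derivable1_diffP.
  have dm := is_derive_mixture x.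
  have m0 : mixture x != 0 by rewrite gt_eqF ?mixture_gt0.
  by have [] := is_deriveV m0 dm.
apply: measurable_funM => //.
have ms c : measurable_fun setT (shift_score c).
  by apply: measurable_funB => //; apply: measurable_funM => //; apply: measurable_funB.
by apply: measurable_funD; apply: measurable_funM => //; apply: measurable_funM => //;
  exact: measurable_normal_pdf.
Qed.

Lemma is_derive_ln_mixture_ratio (x : R) :
  is_derive x 1 (fun y => ln (mixture_ratio y)) (score x).
Proof.
have d := is_derive_mixture_ratio x; have g0 := mixture_ratio_gt0 x.
have dl := is_derive1_ln g0.
have dc : is_derive x 1 (fun y => ln (mixture_ratio y)) _ := is_derive1_comp dl d.
by apply: (is_derive_eq dc); rewrite mulKf ?gt_eqF.
Qed.

Lemma has_integral_mixture (f : R -> R) u v :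
  has_integral (fun x => f x * normal_pdf a s x) u ->
  has_integral (fun x => f x * normal_pdf b s x) v ->
  has_integral (fun x => f x * mixture x) (p * u + (1 - p) * v).
Proof.
move=> hu hv.
apply: has_integral_ext (has_integralD (has_integralZ p hu) (has_integralZ (1 - p) hv)) _ _ => //.
by move=> x; rewrite /mixture; ring.
Qed.

Lemma has_integral_normal_id (c : R) : has_integral (fun x => x * normal_pdf c s x) c.
Proof.
apply: has_integral_ext (has_integralD (has_integral_normal_centered c s0)
  (has_integralZ c (has_integral_normal c s))) _ _; first by move=> x; ring.
by ring.
Qed.

Lemma has_integral_normal_sq (c : R) :
  has_integral (fun x => x ^+ 2 * normal_pdf c s x) (c ^+ 2 + s ^+ 2).
Proof.
apply: has_integral_ext (has_integralD (has_integralD (has_integral_normal_variance c s0)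
  (has_integralZ (2 * c) (has_integral_normal_id c)))
  (has_integralZ (- c ^+ 2) (has_integral_normal c s))) _ _; first by move=> x; ring.
by ring.
Qed.

Lemma has_integral_mixture1 : has_integral mixture 1.
Proof.
have h c : has_integral (fun x => 1 * normal_pdf c s x) 1.
  apply: has_integral_ext (has_integral_normal c s) _ _ => // x; first by rewrite mul1r.
apply: has_integral_ext (has_integral_mixture (h a) (h b)) _ _.
  by move=> x; rewrite mul1r.
by ring.
Qed.

Lemma has_integral_mixture_id :
  has_integral (fun x => x * mixture x) (p * a + (1 - p) * b).
Proof. by apply: has_integral_mixture; exact: has_integral_normal_id. Qed.

Lemma has_integral_mixture_sq : has_integral (fun x => x ^+ 2 * mixture x)
  (p * a ^+ 2 + (1 - p) * b ^+ 2 + s ^+ 2).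
Proof.
apply: has_integral_ext (has_integral_mixture (has_integral_normal_sq a)
  (has_integral_normal_sq b)) _ _ => //; ring.
Qed.

(** Fisher information of [N(0, s^2)] relative to the standard Gaussian; a mean [c] adds [c^2], as
    the expansion [shift_score c x = c + (1 - s^-2) (x - c)] shows. *)
Let kappa := (1 - s ^+ 2) ^+ 2 / s ^+ 2.

Lemma has_integral_shift_score (c : R) :
  has_integral (fun x => shift_score c x ^+ 2 * normal_pdf c s x) (c ^+ 2 + kappa).
Proof.
apply: has_integral_ext (has_integralD (has_integralD
  (has_integralZ ((1 - s ^- 2) ^+ 2) (has_integral_normal_variance c s0))
  (has_integralZ (2 * c * (1 - s ^- 2)) (has_integral_normal_centered c s0)))
  (has_integralZ (c ^+ 2) (has_integral_normal c s))) _ _.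
- by move=> x; rewrite /shift_score; field; rewrite ?gt_eqF.
- by rewrite /kappa; field; rewrite ?gt_eqF.
Qed.

(* With [P, Q] the two weighted components, [rho * score^2] falls short of the
   component-wise sum by [P Q / (P + Q)] times the squared gap of the scores, and
   [P Q / (P + Q) <= sqrt (P Q) / 2], a multiple of the midpoint Gaussian. *)
Lemma fisher_mixture : exists I,
  [/\ has_integral (fun x => score x ^+ 2 * mixture x) I,
      p * a ^+ 2 + (1 - p) * b ^+ 2 + kappa -
        (a - b) ^+ 2 / (2 * s ^+ 4) * (Num.sqrt p * expR (- (a - b) ^+ 2 / (8 * s ^+ 2)))
        <= I
    & I <= p * a ^+ 2 + (1 - p) * b ^+ 2 + kappa].
Proof.
(* Chosen so that [sqrt (P Q)] is exactly [e] times the Gaussian density at the midpoint; [e] is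
   thus the integral of the geometric mean. *)
pose e := Num.sqrt (p * (1 - p)) * expR (- (a - b) ^+ 2 / (8 * s ^+ 2)).
pose U x := p * (shift_score a x ^+ 2 * normal_pdf a s x) +
  (1 - p) * (shift_score b x ^+ 2 * normal_pdf b s x).
have UI : has_integral U (p * a ^+ 2 + (1 - p) * b ^+ 2 + kappa).
  apply: has_integral_ext (has_integralD (has_integralZ p (has_integral_shift_score a))
   (has_integralZ (1 - p) (has_integral_shift_score b))) _ _ => //; ring.
have [I [hI lI uI]] : exists t, [/\ has_integral (fun x => score x ^+ 2 * mixture x) t,
   p * a ^+ 2 + (1 - p) * b ^+ 2 + kappa - (a - b) ^+ 2 / (2 * s ^+ 4) * e <= t
   & t <= p * a ^+ 2 + (1 - p) * b ^+ 2 + kappa].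
  have := has_integral_between _ (has_integralB UI
    (has_integralZ ((a - b) ^+ 2 / (2 * s ^+ 4) * e)
       (has_integral_normal ((a + b) / 2) s))) UI.
  rewrite mulr1; apply.
    by apply: measurable_funM; [apply: measurable_funX; exact: measurable_score
                               |exact: measurable_mixture].
  move=> x; have m0 := mixture_gt0 x.
  set P := p * normal_pdf a s x; set Q := (1 - p) * normal_pdf b s x.
  have P0 : 0 < P by rewrite mulr_gt0 ?normal_pdf_gt0.
  have Q0 : 0 < Q by rewrite mulr_gt0 ?subr_gt0 ?normal_pdf_gt0.
  have dE : score x ^+ 2 * mixture x = U x - P * Q / (P + Q) * ((a - b) ^+ 2 / s ^+ 4).
    rewrite /score /U /mixture -/P -/Q.
    have -> : p * (shift_score a x ^+ 2 * normal_pdf a s x) = P * shift_score a x ^+ 2.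
      by rewrite /P; ring.
    have -> : (1 - p) * (shift_score b x ^+ 2 * normal_pdf b s x) =
      Q * shift_score b x ^+ 2 by rewrite /Q; ring.
    by rewrite /shift_score; field; rewrite !gt_eqF ?addr_gt0.
  have eE : (e * normal_pdf ((a + b) / 2) s x) ^+ 2 = P * Q.
    rewrite /e !exprMn sqr_sqrtr; last by rewrite mulr_ge0 ?ltW ?subr_gt0.
    rewrite /P /Q (normal_pdf_change a ((a + b) / 2) x s0 s0).
    rewrite (normal_pdf_change b ((a + b) / 2) x s0 s0) divff ?gt_eqF// !mul1r.
    set A := expR (_ - (x - a) ^+ 2 / _); set B := expR (_ - (x - b) ^+ 2 / _).
    have AB : A * B = expR (- (a - b) ^+ 2 / (8 * s ^+ 2)) ^+ 2.
      rewrite expr2 -!expRD; congr expR; field; rewrite ?gt_eqF//.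
    by rewrite -AB; ring.
  have e0 : 0 <= e * normal_pdf ((a + b) / 2) s x.
    by rewrite !mulr_ge0 ?sqrtr_ge0 ?expR_ge0 ?normal_pdf_ge0.
  have eA c : c * e * normal_pdf ((a + b) / 2) s x =
     c * (e * normal_pdf ((a + b) / 2) s x) by rewrite -mulrA.
  set E := e * _ in eE e0 eA; clearbody E P Q.
  have PQ : P * Q / (P + Q) <= E / 2.
    rewrite ler_pdivrMr ?addr_gt0// -eE.
    have : 0 <= E * (P + Q - 2 * E).
      rewrite mulr_ge0// subr_ge0 -(ler_pXn2r (ltn0Sn 1)) ?nnegrE; last 2 first.
        - lra.
        - lra.
      by rewrite exprMn eE; have := sqr_ge0 (P - Q); lra.
    by move=> ?; lra.
  have k0 : 0 <= (a - b) ^+ 2 / s ^+ 4.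
    by rewrite divr_ge0 ?sqr_ge0// exprn_ge0 ?ltW.
  rewrite dE eA; apply/andP; split.
    have -> : (a - b) ^+ 2 / (2 * s ^+ 4) * E = E / 2 * ((a - b) ^+ 2 / s ^+ 4).
      by field; rewrite ?gt_eqF.
    by rewrite lerB// ler_wpM2r.
  by rewrite lerBlDr lerDl mulr_ge0// divr_ge0 ?mulr_ge0 ?addr_ge0 ?ltW.
(* It remains to relax [sqrt (p (1 - p))] to [sqrt p], which becomes [1 / r] for [p = r^-2]. *)
exists I; split=> //; apply: le_trans lI; rewrite lerB//.
apply: ler_wpM2l; first by rewrite divr_ge0 ?sqr_ge0 ?mulr_ge0 ?exprn_ge0 ?(ltW s0).
apply: ler_wpM2r; first exact: expR_ge0.
by apply: ler_wsqrtr; rewrite ler_piMr ?(ltW p0)// gerBl ltW.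
Qed.

(** Log-likelihood ratio of [N(c, s^2)] against the standard Gaussian; its mean under [N(c, s^2)] is
    the relative entropy of that component. *)
Let llr (c x : R) := x ^+ 2 / 2 - (x - c) ^+ 2 / (2 * s ^+ 2) - ln s.

Lemma normal_pdf_llr c x : normal_pdf c s x / normal_pdf 0 1 x = expR (llr c x).
Proof.
rewrite (normal_pdf_change c 0 x ltr01 s0) mulrC mulKf ?gt_eqF ?normal_pdf_gt0//.
by rewrite /llr [in RHS]expRD expRN lnK ?posrE// subr0 expr1n mulr1 mul1r mulrC.
Qed.

Lemma has_integral_llr c : has_integral (fun x => llr c x * normal_pdf c s x)
  ((c ^+ 2 + s ^+ 2 - 1) / 2 - ln s).
Proof.
apply: has_integral_ext (has_integralB (has_integralB
  (has_integralZ 2^-1 (has_integral_normal_sq c))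
  (has_integralZ (2 * s ^+ 2)^-1 (has_integral_normal_variance c s0)))
  (has_integralZ (ln s) (has_integral_normal c s))) _ _.
- by move=> x; rewrite /llr; field; rewrite ?gt_eqF.
- by field; rewrite ?gt_eqF.
Qed.

(** The upper bound is convexity of [t ln t] applied pointwise to the two likelihood ratios [u] and
    [v]. The lower bound holds because the mixed ratio is at least each of [p u] and [(1 - p) v],
    which costs at most the binary entropy of [p]. *)
Lemma entropy_mixture : exists H,
  [/\ has_integral (fun x => ln (mixture_ratio x) * mixture x) H,
      (p * a ^+ 2 + (1 - p) * b ^+ 2 + s ^+ 2 - 1) / 2 - ln s +
        (p * ln p + (1 - p) * ln (1 - p)) <= H
    & H <= (p * a ^+ 2 + (1 - p) * b ^+ 2 + s ^+ 2 - 1) / 2 - ln s].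
Proof.
pose U x := p * (llr a x * normal_pdf a s x) + (1 - p) * (llr b x * normal_pdf b s x).
have UI : has_integral U ((p * a ^+ 2 + (1 - p) * b ^+ 2 + s ^+ 2 - 1) / 2 - ln s).
  apply: has_integral_ext (has_integralD (has_integralZ p (has_integral_llr a))
   (has_integralZ (1 - p) (has_integral_llr b))) _ _ => //; by field.
pose V x := ln p * (p * normal_pdf a s x) + ln (1 - p) * ((1 - p) * normal_pdf b s x).
have VI : has_integral V (p * ln p + (1 - p) * ln (1 - p)).
  apply: has_integral_ext (has_integralD
   (has_integralZ (ln p) (has_integralZ p (has_integral_normal a s)))
   (has_integralZ (ln (1 - p)) (has_integralZ (1 - p) (has_integral_normal b s)))) _ _ => //.
  by ring.
apply: has_integral_between (has_integralD UI VI) UI _.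
  apply: measurable_funM; last exact: measurable_mixture.
  apply: measurableT_comp; [exact: measurable_ln|exact: measurable_mixture_ratio].
move=> x; set z := normal_pdf 0 1 x.
have z0 : 0 < z by exact: normal_pdf_gt0.
set u := expR (llr a x); set v := expR (llr b x).
have u0 : 0 < u by exact: expR_gt0.
have v0 : 0 < v by exact: expR_gt0.
have qa : normal_pdf a s x = u * z by rewrite /u -normal_pdf_llr divfK ?gt_eqF.
have qb : normal_pdf b s x = v * z by rewrite /v -normal_pdf_llr divfK ?gt_eqF.
have la : llr a x = ln u by rewrite /u expRK.
have lb : llr b x = ln v by rewrite /v expRK.
have gE : mixture_ratio x = p * u + (1 - p) * v.
  by rewrite /mixture_ratio /mixture qa qb -/z; field; rewrite ?gt_eqF.
have p1' : 0 < 1 - p by rewrite subr_gt0.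
set g := mixture_ratio x in gE *.
have g0 : 0 < g by exact: mixture_ratio_gt0.
have mE : mixture x = g * z by rewrite /g /mixture_ratio divfK ?gt_eqF.
rewrite /U /V mE qa qb la lb; apply/andP; split.
  have lu : ln p + ln u <= ln g.
    have le : p * u <= g by rewrite gE lerDl mulr_ge0 ?ltW.
    by rewrite -lnM ?posrE// ler_ln// posrE mulr_gt0.
  have lv : ln (1 - p) + ln v <= ln g.
    have le : (1 - p) * v <= g by rewrite gE lerDr mulr_ge0 ?ltW.
    by rewrite -lnM ?posrE// ler_ln// posrE mulr_gt0.
  rewrite -subr_ge0.
  have -> : ln g * (g * z) - (p * (ln u * (u * z)) + (1 - p) * (ln v * (v * z)) +
     (ln p * (p * (u * z)) + ln (1 - p) * ((1 - p) * (v * z)))) =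
     z * (p * u * (ln g - (ln p + ln u)) + (1 - p) * v * (ln g - (ln (1 - p) + ln v))).
    by rewrite gE; ring.
  by rewrite mulr_ge0 ?addr_ge0 ?mulr_ge0 ?subr_ge0// ltW.
(* Tangent line of [w ln w] at [g]. Averaged over [w = u] and [w = v], the terms [w - g] cancel
   because [g] is the barycenter. *)
have ent w : 0 < w -> w * ln g + w - g <= w * ln w.
  move=> w0; have gw : 0 < g / w by rewrite divr_gt0.
  have := le_ln1Dx (x := g / w - 1); rewrite addrCA subrr addr0 ln_div ?posrE//.
  have gw1 : -1 < g / w - 1 by rewrite ltrBrDr addNr.
  move=> /(_ gw1); rewrite -(ler_pM2l w0).
  have -> : w * (g / w - 1) = g - w by field; rewrite ?gt_eqF.
  by rewrite mulrBr; lra.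
rewrite -subr_ge0.
have -> : p * (ln u * (u * z)) + (1 - p) * (ln v * (v * z)) - ln g * (g * z) =
   z * (p * (u * ln u - (u * ln g + u - g)) + (1 - p) * (v * ln v - (v * ln g + v - g))).
  by rewrite gE; ring.
have := ent _ u0; have := ent _ v0 => ev eu.
by rewrite mulr_ge0 ?addr_ge0 ?mulr_ge0 ?subr_ge0// ltW.
Qed.

End Mixture.

(** * Iterated integrals *)

Section IteratedIntegral.
Context {R : realType}.
Local Notation mu := (@lebesgue_measure R).
Implicit Types n : nat.

Lemma measurable_tcons d (T : measurableType d) n (f : T -> R) (g : T -> n.-tuple R) :
  measurable_fun setT f -> measurable_fun setT g ->
  measurable_fun setT (fun x => tcons (f x) (g x)).
Proof. exact: measurable_cons. Qed.

Lemma leb_iint_ge0 n (F : n.-tuple R -> \bar R) :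
  (forall x, 0 <= F x)%E -> (0 <= leb_iint F)%E.
Proof. by elim: n F => [|n IH] F F0 //=; apply: integral_ge0 => x _; exact: IH. Qed.

(** The parameter space is arbitrary and quantified inside the induction: the step moves the first
    coordinate into the parameter, applies the induction hypothesis to [T * R], and integrates that
    coordinate out by Tonelli. *)
Lemma measurable_leb_iint n : forall d (T : measurableType d)
    (F : T * n.-tuple R -> \bar R),
  measurable_fun setT F -> (forall z, 0 <= F z)%E ->
  measurable_fun setT (fun x => leb_iint (fun t => F (x, t))).
Proof.
elim: n => [|n IH] d T F mF F0 /=.
  by apply: measurableT_comp => //; exact: measurable_fun_pair.
pose G (z : T * R) := leb_iint (fun t => F (z.1, tcons z.2 t)).
apply: (@measurable_fun_fubini_tonelli_F _ _ _ _ _ mu G); last first.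
  by move=> z; exact: leb_iint_ge0.
apply: (IH _ _ (fun w : (T * R) * n.-tuple R => F (w.1.1, tcons w.1.2 w.2))) => //.
apply: measurableT_comp => //; apply: measurable_fun_pair.
  exact: (measurableT_comp measurable_fst).
apply: measurable_tcons => //; exact: (measurableT_comp measurable_snd).
Qed.

Lemma measurable_fiber n (F : n.+1.-tuple R -> \bar R) x :
  measurable_fun setT F -> measurable_fun setT (fun t => F (tcons x t)).
Proof. by move=> mF; apply: measurableT_comp => //; exact: measurable_tcons. Qed.

Lemma measurable_leb_iint_fiber n (F : n.+1.-tuple R -> \bar R) :
  measurable_fun setT F -> (forall z, 0 <= F z)%E ->
  measurable_fun setT (fun x => leb_iint (fun t => F (tcons x t))).
Proof.
move=> mF F0.
apply: (@measurable_leb_iint n _ R (fun z => F (tcons z.1 z.2))) => //.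
by apply: measurableT_comp => //; exact: measurable_tcons.
Qed.

Lemma leb_iintD n (F G : n.-tuple R -> \bar R) :
  measurable_fun setT F -> (forall z, 0 <= F z)%E ->
  measurable_fun setT G -> (forall z, 0 <= G z)%E ->
  leb_iint (fun x => F x + G x)%E = (leb_iint F + leb_iint G)%E.
Proof.
elim: n F G => [|n IH] F G mF F0 mG G0 //=.
rewrite -ge0_integralD//; try exact: measurable_leb_iint_fiber.
- by apply: eq_integral => x _; rewrite IH//; exact: measurable_fiber.
- by move=> x _; exact: leb_iint_ge0.
- by move=> x _; exact: leb_iint_ge0.
Qed.

Lemma leb_iintZ n (F : n.-tuple R -> \bar R) (k : R) : 0 <= k ->
  measurable_fun setT F -> (forall z, 0 <= F z)%E ->
  leb_iint (fun x => k%:E * F x)%E = (k%:E * leb_iint F)%E.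
Proof.
move=> k0; elim: n F => [|n IH] F mF F0 //=.
rewrite -ge0_integralZl//; try exact: measurable_leb_iint_fiber.
- by apply: eq_integral => x _; rewrite IH//; exact: measurable_fiber.
- by move=> x _; exact: leb_iint_ge0.
Qed.

Lemma leb_iint_le n (F G : n.-tuple R -> \bar R) :
  measurable_fun setT F -> (forall z, 0 <= F z)%E ->
  measurable_fun setT G -> (forall z, F z <= G z)%E ->
  (leb_iint F <= leb_iint G)%E.
Proof.
elim: n F G => [|n IH] F G mF F0 mG FG //=.
have G0 z : (0 <= G z)%E by exact: le_trans (F0 z) (FG z).
apply: ge0_le_integral => //; try exact: measurable_leb_iint_fiber.
- by move=> x _; exact: leb_iint_ge0.
- by move=> x _; apply: IH => //; exact: measurable_fiber.
Qed.

Lemma leb_iint0 n : leb_iint (fun _ : n.-tuple R => 0%E) = 0%E.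
Proof. by elim: n => //= n IH; rewrite integral0_eq// => x _; exact: IH. Qed.

Lemma leb_int_ge0E n (F : n.-tuple R -> \bar R) :
  (forall x, 0 <= F x)%E -> leb_int F = leb_iint F.
Proof.
move=> F0; rewrite /leb_int.
have -> : (F ^\+)%E = F by apply/funext => x; rewrite funeposE max_l.
have -> : (F ^\-)%E = (fun=> 0%E).
  by apply/funext => x; rewrite funenegE max_r// oppe_le0.
by rewrite leb_iint0 sube0.
Qed.

Definition has_iint_ge0 n (F : n.-tuple R -> R) (r : R) :=
  [/\ measurable_fun setT F, forall x, 0 <= F x
    & leb_iint (fun x => (F x)%:E) = r%:E].

(** Any decomposition into nonnegative functions with finite integrals is allowed, not only the
    positive and negative parts: such decompositions add and multiply, whereas those parts do
    not. *)
Definition has_iint n (F : n.-tuple R -> R) (r : R) := exists F1 F2 r1 r2,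
  [/\ has_iint_ge0 F1 r1, has_iint_ge0 F2 r2, F =1 (fun x => F1 x - F2 x)
    & r = r1 - r2].

Lemma has_iint_ge0D n (F G : n.-tuple R -> R) r s :
  has_iint_ge0 F r -> has_iint_ge0 G s ->
  has_iint_ge0 (fun x => F x + G x) (r + s).
Proof.
move=> [mF F0 Fr] [mG G0 Gs]; split.
- exact: measurable_funD.
- by move=> x; rewrite addr_ge0.
- rewrite EFinD -Fr -Gs -leb_iintD//; exact/measurable_EFinP.
Qed.

Lemma has_iint_ext n (F : n.-tuple R -> R) G r s :
  has_iint F r -> F =1 G -> r = s -> has_iint G s.
Proof. by move=> + /funext <- <-. Qed.

Lemma has_iintD n (F G : n.-tuple R -> R) r s :
  has_iint F r -> has_iint G s -> has_iint (fun x => F x + G x) (r + s).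
Proof.
move=> [F1 [F2 [r1 [r2 [hF1 hF2 FE ->]]]]] [G1 [G2 [s1 [s2 [hG1 hG2 GE ->]]]]].
exists (fun x => F1 x + G1 x), (fun x => F2 x + G2 x), (r1 + s1), (r2 + s2); split.
- exact: has_iint_ge0D.
- exact: has_iint_ge0D.
- by move=> x; rewrite FE GE; ring.
- by ring.
Qed.

Lemma has_iint0 n : has_iint (fun _ : n.-tuple R => 0) 0.
Proof.
have h : has_iint_ge0 (fun _ : n.-tuple R => (0 : R)) 0 by split => //; exact: leb_iint0.
by exists (fun _ : n.-tuple R => (0 : R)), (fun _ => 0), 0, 0; split=> // [x|]; rewrite subrr.
Qed.

Lemma has_iint_sum n (I : finType) (F : I -> n.-tuple R -> R) (r : I -> R) :
  (forall i, has_iint (F i) (r i)) ->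
  has_iint (fun x => \sum_i F i x) (\sum_i r i).
Proof.
move=> h; have E (s : seq I) :
    has_iint (fun x => \sum_(i <- s) F i x) (\sum_(i <- s) r i).
  elim: s => [|i s IH].
    apply: has_iint_ext (has_iint0 n) _ _ => [x|]; by rewrite !big_nil.
  apply: has_iint_ext (has_iintD (h i) IH) _ _ => [x|]; by rewrite big_cons.
by have := E (index_enum I).
Qed.

(** The positive part lies below [F1] and the negative part below [F2], so both have finite
    integrals. Integrating the identity [F^+ + F2 = F^- + F1] between nonnegative functions then
    gives the value. *)
Lemma leb_int_has_iint n (F : n.-tuple R -> R) r :
  has_iint F r -> leb_int (fun x => (F x)%:E) = r%:E.
Proof.
move=> [F1 [F2 [r1 [r2 [[mF1 F10 F1r] [mF2 F20 F2r] FE ->]]]]].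
have mF : measurable_fun setT (EFin \o F).
  rewrite (_ : F = fun x => F1 x - F2 x); last exact/funext.
  by apply/measurable_EFinP; exact: measurable_funB.
rewrite /leb_int -/(EFin \o F).
have mp : measurable_fun setT ((EFin \o F) ^\+)%E by exact: measurable_funepos.
have mn : measurable_fun setT ((EFin \o F) ^\-)%E by exact: measurable_funeneg.
have mE1 : measurable_fun setT (fun x => (F1 x)%:E) by exact/measurable_EFinP.
have mE2 : measurable_fun setT (fun x => (F2 x)%:E) by exact/measurable_EFinP.
have posE x : ((EFin \o F) ^\+ x = (Num.max (F x) 0)%:E)%E.
  by rewrite funeposE /= EFin_max.
have negE x : ((EFin \o F) ^\- x = (Num.max (- F x) 0)%:E)%E.
  by rewrite funenegE /= EFin_max.
have lp : (leb_iint ((EFin \o F) ^\+) <= r1%:E)%E.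
  rewrite -F1r; apply: leb_iint_le => // x; rewrite posE lee_fin ge_max F10 FE.
  by rewrite gerBl F20.
have ln : (leb_iint ((EFin \o F) ^\-) <= r2%:E)%E.
  rewrite -F2r; apply: leb_iint_le => // x; rewrite negE lee_fin ge_max F20 FE.
  by rewrite opprB gerBl F10.
have lp0 : (0 <= leb_iint ((EFin \o F) ^\+))%E by exact: leb_iint_ge0.
have ln0 : (0 <= leb_iint ((EFin \o F) ^\-))%E by exact: leb_iint_ge0.
have E : (leb_iint ((EFin \o F) ^\+) + r2%:E = leb_iint ((EFin \o F) ^\-) + r1%:E)%E.
  rewrite -F1r -F2r -!leb_iintD//.
  congr leb_iint; apply/funext => x; rewrite posE negE -!EFinD FE; congr EFin.
  by rewrite opprB; case: (leP (F1 x - F2 x) 0); case: (leP (F2 x - F1 x) 0); lra.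
move: lp ln lp0 ln0 E.
case: (leb_iint (_ ^\+)%E) => [u| |] //; case: (leb_iint (_ ^\-)%E) => [v| |] //.
move=> _ _ _ _ [E]; rewrite -EFinB; congr EFin; lra.
Qed.

Lemma has_iint_ge0_cons n (h : R -> R) (G : n.-tuple R -> R) u r :
  has_integral h u -> (forall x, 0 <= h x) -> has_iint_ge0 G r ->
  has_iint_ge0 (fun x => h (thead x) * G [tuple of behead x]) (u * r).
Proof.
move=> [hi hu] h0 [mG G0 Gr]; split.
- apply: measurable_funM.
    apply: measurableT_comp; last exact: measurable_tnth.
    by move: hi => /measurable_int /measurable_EFinP.
  by apply: measurableT_comp => //; exact: measurable_behead.
- by move=> x; rewrite mulr_ge0.
- have E x : leb_iint (fun t : n.-tuple R =>
      (h (thead (tcons x t)) * G [tuple of behead (tcons x t)])%:E) = (r%:E * (h x)%:E)%E.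
    rewrite muleC -Gr -leb_iintZ//; last exact/measurable_EFinP.
    congr leb_iint; apply/funext => t; rewrite EFinM; congr (_%:E * (G _)%:E)%E.
    exact/val_inj.
  rewrite /=; under eq_integral do rewrite E.
  by rewrite integralZl// hu -EFinM mulrC.
Qed.

Lemma has_integral_posneg (h : R -> R) u : has_integral h u -> exists h1 h2 u1 u2,
  [/\ has_integral h1 u1 /\ (forall x, 0 <= h1 x),
      has_integral h2 u2 /\ (forall x, 0 <= h2 x),
      h =1 (fun x => h1 x - h2 x) & u = u1 - u2].
Proof.
move=> hu; have fi (f : R -> R) : mu.-integrable setT (EFin \o f) ->
    has_integral f (fine (\int[mu]_x (f x)%:E)%E).
  by move=> fi; split=> //; rewrite fineK//; exact: (integrable_fin_num _ fi).
have hp := fi _ (integrable_funrpos measurableT hu.1).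
have hn := fi _ (integrable_funrneg measurableT hu.1).
have hE : h =1 (fun x => h ^\+%R x - h ^\-%R x) by move=> x; rewrite -{1}(funrposBneg h).
exists (h ^\+)%R, (h ^\-)%R, (fine (\int[mu]_x (h ^\+%R x)%:E)%E),
  (fine (\int[mu]_x (h ^\-%R x)%:E)%E); split.
- by split=> // x; exact: funrpos_ge0.
- by split=> // x; exact: funrneg_ge0.
- exact: hE.
- have hB := has_integralB hp hn; apply/eqP; rewrite eq_le; apply/andP; split.
    by apply: has_integral_le hu hB _ => x; rewrite -hE.
  by apply: has_integral_le hB hu _ => x; rewrite -hE.
Qed.

(** The product [(h1 - h2) (G1 - G2)] is regrouped as [h1 G1 + h2 G2] minus [h1 G2 + h2 G1], both
    nonnegative. *)
Lemma has_iint_cons n (h : R -> R) (G : n.-tuple R -> R) u r :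
  has_integral h u -> has_iint G r ->
  has_iint (fun x => h (thead x) * G [tuple of behead x]) (u * r).
Proof.
move=> /has_integral_posneg[h1 [h2 [u1 [u2 [[hu1 h10] [hu2 h20] hE ->]]]]].
move=> [G1 [G2 [r1 [r2 [hG1 hG2 GE ->]]]]].
have c11 := has_iint_ge0_cons hu1 h10 hG1.
have c12 := has_iint_ge0_cons hu1 h10 hG2.
have c21 := has_iint_ge0_cons hu2 h20 hG1.
have c22 := has_iint_ge0_cons hu2 h20 hG2.
do 4 eexists; split; [exact: (has_iint_ge0D c11 c22)|exact: (has_iint_ge0D c12 c21)| |].
- by move=> x /=; rewrite hE GE; ring.
- by ring.
Qed.

Lemma has_iint_prod n (h : 'I_n -> R -> R) (r : 'I_n -> R) :
  (forall i, has_integral (h i) (r i)) ->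
  has_iint (fun x : n.-tuple R => \prod_i h i (tnth x i)) (\prod_i r i).
Proof.
elim: n h r => [|n IH] h r hr.
  exists (fun=> 1), (fun=> 0), 1, 0; split.
  - by split.
  - by split.
  - by move=> x; rewrite big_ord0 subr0.
  - by rewrite big_ord0 subr0.
apply: has_iint_ext (has_iint_cons (hr ord0) (IH _ _ (fun i => hr (lift ord0 i)))) _ _.
  move=> x; rewrite big_ord_recl; congr (_ * _).
  apply: eq_bigr => i _; congr (h _ _).
  by rewrite [in RHS](tuple_eta x) tnthS.
by rewrite big_ord_recl.
Qed.

End IteratedIntegral.

(** * Laws with a density, tensor powers *)

Section LawDensity.
Context {R : realType} d (T : measurableType d) (P : {measure set T -> \bar R}).
Local Notation mu := (@lebesgue_measure R).
Variables (X : T -> R) (rho : R -> R).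
Hypotheses (mX : measurable_fun setT X) (mrho : measurable_fun setT rho)
  (rho0 : forall x, 0 <= rho x)
  (law : forall B, measurable B -> P (X @^-1` B) = (\int[mu]_(x in B) (rho x)%:E)%E).

Import HBNNSimple.

Let integral_law_indic (B : set R) : measurable B ->
  (\int[P]_z (\1_B (X z))%:E = \int[mu]_x (\1_B x * rho x)%:E)%E.
Proof.
move=> mB; have mXB : measurable (X @^-1` B) by rewrite -[X in measurable X]setTI; exact: mX.
rewrite (_ : (fun z => (\1_B (X z))%:E) = fun z => (\1_(X @^-1` B) z)%:E)//.
rewrite integral_indic// setIT law// integral_mkcond; apply: eq_integral => x _.
by rewrite patchE indicE; case: (x \in B); rewrite ?mul1r ?mul0r.
Qed.

Let integral_law_nnsfun (f : {nnsfun R >-> R}) :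
  (\int[P]_z (f (X z))%:E = \int[mu]_x (f x * rho x)%:E)%E.
Proof.
have mi r : measurable_fun setT (fun x => \1_(f @^-1` [set r]) x : R).
  exact: measurable_indic.
under eq_integral do rewrite fimfunE -fsumEFin//.
rewrite ge0_integral_fsum//; last 2 first.
  - move=> r; apply/measurable_EFinP; apply: measurable_funM => //.
    exact: measurableT_comp.
  - by move=> r z _; rewrite EFinM nnfun_muleindic_ge0.
under [RHS]eq_integral.
  move=> x _; rewrite EFinM fimfunE -fsumEFin// ge0_mule_fsuml; last first.
    by move=> r; rewrite EFinM nnfun_muleindic_ge0.
  over.
rewrite [RHS]ge0_integral_fsum//; last 2 first.
  - move=> r; apply: emeasurable_funM; apply/measurable_EFinP; last exact: mrho.
    by apply: measurable_funM; [exact: measurable_cst|exact: mi].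
  - by move=> r x _; apply: mule_ge0; [rewrite EFinM nnfun_muleindic_ge0|rewrite lee_fin].
apply: eq_fsbigr => r /[!inE] -[x _ <-].
transitivity ((f x)%:E * \int[P]_z (\1_(f @^-1` [set f x]) (X z))%:E)%E.
  rewrite -ge0_integralZl//; last by rewrite lee_fin.
  by apply/measurable_EFinP; apply: measurableT_comp => //; exact: mi.
rewrite integral_law_indic// -ge0_integralZl//.
- by apply: eq_integral => y _; rewrite !EFinM muleA.
- by apply/measurable_EFinP; apply: measurable_funM; [exact: mi|exact: mrho].
- by move=> y _; rewrite lee_fin mulr_ge0.
- by rewrite lee_fin.
Qed.

(** Change of variables, carried from indicators to simple functions by linearity and then to
    nonnegative functions by monotone convergence. *)
Lemma integral_law (f : R -> R) : measurable_fun setT f -> (forall x, 0 <= f x) ->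
  (\int[P]_z (f (X z))%:E = \int[mu]_x (f x * rho x)%:E)%E.
Proof.
move=> mf f0; have mf' : measurable_fun setT (EFin \o f) by exact/measurable_EFinP.
pose f_ := nnsfun_approx measurableT mf'.
have cf x : ((f_ n x)%:E @[n --> \oo] --> (f x)%:E)%E.
  by apply: (cvg_nnsfun_approx measurableT mf') => // y _; rewrite lee_fin.
have mf_ n : measurable_fun setT (f_ n : R -> R) by exact: measurable_funPT.
have nd x : {homo (fun n => f_ n x) : m n / (m <= n)%N >-> m <= n}.
  by move=> m n mn; exact/lefP/nd_nnsfun_approx.
transitivity (lim (\int[P]_z (f_ n (X z))%:E @[n --> \oo])%E).
  rewrite -monotone_convergence//=.
  - by apply: eq_integral => z _; apply/esym/cvg_lim => //; exact: cf.
  - by move=> n; apply/measurable_EFinP; exact: measurableT_comp.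
  - by move=> n z _; rewrite lee_fin.
  - by move=> z _ m n mn; rewrite lee_fin nd.
rewrite (_ : (fun n => _) = fun n => (\int[mu]_x (f_ n x * rho x)%:E)%E); last first.
  by apply/funext => n; exact: integral_law_nnsfun.
rewrite -monotone_convergence//=.
- apply: eq_integral => x _; apply/cvg_lim => //.
  have := cf x; move/fine_cvgP => -[_ c].
  by apply/fine_cvgP; split; [exact: nearW|apply: cvgMl].
- by move=> n; apply/measurable_EFinP; apply: measurable_funM; [exact: mf_|exact: mrho].
- by move=> n x _; rewrite lee_fin mulr_ge0.
- by move=> x _ m n mn; rewrite lee_fin ler_wpM2r// nd.
Qed.

End LawDensity.

(** * Product densities: integrals of coordinate functions and marginals *)

Section Tensor.
Context {R : realType}.
Local Notation mu := (@lebesgue_measure R).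
Implicit Types n : nat.

Definition tensor n (g : R -> R) (x : n.-tuple R) : R := \prod_(i < n) g (tnth x i).

Lemma gauss_densE n (m x : n.-tuple R) :
  gauss_dens m x = \prod_(i < n) normal_pdf (tnth m i) 1 (tnth x i).
Proof.
rewrite /gauss_dens; under [RHS]eq_bigr do rewrite normal_pdf_expR//.
rewrite big_split/= prodr_const card_ord exprVn; congr (_ * _).
rewrite -sumrN mulr_suml expR_sum; apply: eq_bigr => i _.
by rewrite invr1 mul1r expr1n mulr1.
Qed.

(** Presents a function of one coordinate as a product over all coordinates, the form that
    [has_iint_prod] integrates. *)
Lemma prodr_single n (i : 'I_n) (u : R -> R) (x : n.-tuple R) :
  \prod_(j < n) (if j == i then u (tnth x j) else 1) = u (tnth x i).
Proof.
by rewrite (bigD1 i)//= eqxx big1 ?mulr1// => j /negPf ->.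
Qed.

Section Density.
Variables (n : nat) (rho : R -> R).
Hypothesis rho1 : has_integral rho 1.

Lemma has_iint_coord (i : 'I_n) (u : R -> R) r :
  has_integral (fun x => u x * rho x) r ->
  has_iint (fun x : n.-tuple R => u (tnth x i) * tensor rho x) r.
Proof.
move=> ur; pose h j := if j == i then fun x => u x * rho x else rho.
apply: has_iint_ext (has_iint_prod (n := n) (h := h) (r := fun j => if j == i then r else 1) _) _ _.
- by move=> j; rewrite /h; case: ifP.
- move=> x; rewrite -(prodr_single i u) -big_split/=; apply: eq_bigr => j _.
  by rewrite /h; case: ifP; rewrite ?mul1r.
- by rewrite (bigD1 i)//= eqxx big1 ?mulr1// => j /negPf ->.
Qed.

Lemma has_iint_coord2 (i j : 'I_n) (u v : R -> R) r t : i != j ->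
  has_integral (fun x => u x * rho x) r ->
  has_integral (fun x => v x * rho x) t ->
  has_iint (fun x : n.-tuple R => u (tnth x i) * v (tnth x j) * tensor rho x) (r * t).
Proof.
move=> ij ur vt.
pose h k := if k == i then fun x => u x * rho x
  else if k == j then fun x => v x * rho x else rho.
apply: has_iint_ext (has_iint_prod (n := n) (h := h)
  (r := fun k => if k == i then r else if k == j then t else 1) _) _ _.
- by move=> k; rewrite /h; case: ifP => // _; case: ifP.
- move=> x; rewrite -(prodr_single i u) -(prodr_single j v) -!big_split/=.
  apply: eq_bigr => k _; rewrite /h; case: (eqVneq k i) => [->|_].
    by rewrite (negPf ij) mulr1.
  by case: ifP; rewrite !mul1r.
- rewrite (bigD1 i)//= eqxx; congr (_ * _).
  rewrite (bigD1 j) ?[_ == i]eq_sym//= (negPf ij) eqxx big1 ?mulr1// => k /andP[/negPf -> /negPf ->].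
  by [].
Qed.

End Density.

(** Marginal law of one coordinate. The factors may vary with the coordinate, as they do for a
    Gaussian with arbitrary mean vector. *)
Lemma leb_iint_coord n (i : 'I_n) (B : set R) (rho : 'I_n -> R -> R) :
  measurable B -> (forall j, has_integral (rho j) 1) -> (forall j x, 0 <= rho j x) ->
  leb_iint (fun x : n.-tuple R =>
    (\1_((fun y : n.-tuple R => tnth y i) @^-1` B) x * \prod_j rho j (tnth x j))%:E) =
  (\int[mu]_(x in B) (rho i x)%:E)%E.
Proof.
move=> mB rho1 rho0.
have [r rI] : exists r, has_integral (fun x => \1_B x * rho i x) r.
  apply: has_integral_dominated (rho1 i) _.
    apply: measurable_funM; first exact: measurable_indic.
    exact: has_integral_measurable (rho1 i).
  move=> x; rewrite ger0_norm ?mulr_ge0// indicE; case: (_ \in _).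
    by rewrite mul1r.
  by rewrite mul0r.
rewrite integral_mkcond (_ : integral _ _ _ = r%:E); last first.
  rewrite -rI.2; apply: eq_integral => x _.
  by rewrite patchE indicE; case: (x \in B); rewrite ?mul1r ?mul0r.
rewrite -leb_int_ge0E; last by move=> x; rewrite lee_fin mulr_ge0// prodr_ge0.
apply: leb_int_has_iint.
pose h j := if j == i then fun x => \1_B x * rho i x else rho j.
apply: has_iint_ext (has_iint_prod (n := n) (h := h) (r := fun j => if j == i then r else 1) _) _ _.
- by move=> j; rewrite /h; case: ifP.
- move=> x; rewrite (_ : \1__ x = \1_B (tnth x i))// -(prodr_single i (\1_B)) -big_split/=.
  by apply: eq_bigr => j _; rewrite /h; case: (eqVneq j i) => [->|_] //; rewrite mul1r.
- by rewrite (bigD1 i)//= eqxx big1 ?mulr1// => j /negPf ->.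
Qed.

End Tensor.

Lemma ln_prod {R : realType} n (h : 'I_n -> R) : (forall i, 0 < h i) ->
  ln (\prod_i h i) = \sum_i ln (h i).
Proof.
move=> h0; suff [] : 0 < \prod_i h i /\ ln (\prod_i h i) = \sum_i ln (h i) by [].
apply: (big_rec2 (fun y z => 0 < y /\ ln y = z)); first by rewrite ln1.
move=> i z y _ [y0 <-]; split; first exact: mulr_gt0.
by rewrite lnM// posrE.
Qed.

(** * Tensor power of the mixture: regularity, isotropy, deficit, marginals *)

Section TensorMixture.
Context {R : realType}.
Local Notation mu := (@lebesgue_measure R).
Variables (n : nat) (p a b s : R).
Hypotheses (p0 : 0 < p) (p1 : p < 1) (s0 : 0 < s).
Local Notation rho := (mixture p a b s).
Local Notation g := (mixture_ratio p a b s).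
Local Notation f := (tensor g : n.-tuple R -> R).

Lemma tensor_gauss_dens x : f x * gauss_dens (origin n) x = tensor rho x.
Proof.
rewrite gauss_densE -big_split/=; apply: eq_bigr => i _.
by rewrite tnth_mktuple divfK// gt_eqF// normal_pdf_gt0.
Qed.

Lemma dens_int_tensor (G : n.-tuple R -> R) r :
  has_iint (fun x => G x * tensor rho x) r -> dens_int f (fun x => (G x)%:E) = r%:E.
Proof.
move=> /leb_int_has_iint <-; congr leb_int; apply/funext => x.
by rewrite -!EFinM -mulrA tensor_gauss_dens.
Qed.

Lemma tensor_gt0 (x : n.-tuple R) : 0 < f x.
Proof. by apply: prodr_gt0 => i _; exact: mixture_ratio_gt0. Qed.

Lemma measurable_tensor (h : R -> R) : measurable_fun setT h ->
  measurable_fun setT (tensor h : n.-tuple R -> R).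
Proof.
move=> mh; apply: measurable_prod => i _.
by apply: measurableT_comp => //; exact: measurable_tnth.
Qed.

Lemma tensor_tset (h : R -> R) (x : n.-tuple R) i t :
  tensor h (tset x i t) = h t * \prod_(j < n | j != i) h (tnth x j).
Proof.
rewrite /tensor (bigD1 i)//= tnth_mktuple eqxx; congr (_ * _).
by apply: eq_bigr => j /negPf ji; rewrite tnth_mktuple ji.
Qed.

Lemma prob_density_tensor : prob_density f.
Proof.
split.
- by apply: measurable_tensor; exact: measurable_mixture_ratio.
- exact: tensor_gt0.
- move=> x i; rewrite (_ : (fun t => _) =
    fun t => g t * \prod_(j < n | j != i) g (tnth x j)); last first.
    by apply/funext => t; exact: tensor_tset.
  have [dg _] := is_derive_mixture_ratio a b p0 p1 s0 (tnth x i).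
  exact: derivableM.
- rewrite (_ : gint _ = dens_int f (fun x => 1%:E)).
    apply: (dens_int_tensor (G := fun=> 1) (r := 1)).
    have h := has_iint_prod (n := n) (h := fun=> rho) (r := fun=> 1)
      (fun _ => has_integral_mixture1 p a b s).
    apply: has_iint_ext h _ _.
      by move=> x; rewrite mul1r.
    by rewrite big1.
  by rewrite /dens_int; congr gint; apply/funext => x; rewrite mul1e.
Qed.

Lemma partial_ln_tensor i (x : n.-tuple R) :
  partial i (fun y => ln (f y)) x = score p a b s (tnth x i).
Proof.
pose c := \prod_(j < n | j != i) g (tnth x j).
have c0 : 0 < c by apply: prodr_gt0 => j _; exact: mixture_ratio_gt0.
rewrite /partial (_ : (fun t => _) = fun t => ln (g t) + ln c); last first.
  by apply/funext => t; rewrite tensor_tset lnM ?posrE// mixture_ratio_gt0.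
have d := is_derive_ln_mixture_ratio a b p0 p1 s0 (tnth x i).
have dc : is_derive (tnth x i) 1 (fun t => ln (g t) + ln c) _ := is_deriveD d (is_derive_cst (ln c) _ _).
by rewrite derive1E; have [_ ->] := dc; rewrite addr0.
Qed.

Lemma dens_int_coord i : p * a + (1 - p) * b = 0 ->
  dens_int f (fun x => (tnth x i)%:E) = 0%E.
Proof.
move=> ab0; apply: (dens_int_tensor (G := fun x => tnth x i)).
have h1 := has_integral_mixture1 p a b s.
have := has_integral_mixture_id p a b s0; rewrite ab0.
exact: (has_iint_coord h1 i (u := fun x => x)).
Qed.

Lemma dens_int_coordM i j : p * a + (1 - p) * b = 0 ->
  p * a ^+ 2 + (1 - p) * b ^+ 2 + s ^+ 2 = 1 ->
  dens_int f (fun x => (tnth x i * tnth x j)%:E) = ((i == j)%:R)%:E.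
Proof.
move=> ab0 ab1; apply: (dens_int_tensor (G := fun x => tnth x i * tnth x j)).
have h1 := has_integral_mixture1 p a b s.
have [<-|ij] := eqVneq i j.
  have := has_integral_mixture_sq p a b s0; rewrite ab1.
  exact: (has_iint_coord h1 i (u := fun x => x ^+ 2)).
have := has_integral_mixture_id p a b s0; rewrite ab0 => h0.
have := has_iint_coord2 h1 (u := fun x => x) (v := fun x => x) ij h0 h0.
by rewrite mul0r.
Qed.

(** Information and entropy are sums over coordinates, so [D] is [I / 2 - H] for one coordinate. The
    second moments of the atoms cancel in it, and the remaining [ln s] is removed by
    [ln t <= t - 1], at [t = s^2] for the upper bound and at [t = s^-2] for the lower one. *)
Lemma lsdeficit_tensor : exists D : R,
  [/\ lsdeficit f = (n%:R * D)%:E,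
      - ((a - b) ^+ 2 / (4 * s ^+ 4) *
         (Num.sqrt p * expR (- (a - b) ^+ 2 / (8 * s ^+ 2)))) <= D
    & D <= (1 - s ^+ 2) ^+ 2 / (2 * s ^+ 2) - (p * ln p + (1 - p) * ln (1 - p))].
Proof.
have [I [hI lI uI]] := fisher_mixture a b p0 p1 s0.
have [H [hH lH uH]] := entropy_mixture a b p0 p1 s0.
have h1 := has_integral_mixture1 p a b s.
exists (2^-1 * I - H); split.
- rewrite /lsdeficit.
  rewrite (_ : (fun x => (\sum_i partial i _ x ^+ 2)%:E) =
      fun x => (\sum_i score p a b s (tnth x i) ^+ 2)%:E); last first.
    by apply/funext => x; under eq_bigr do rewrite partial_ln_tensor.
  rewrite (dens_int_tensor (G := fun x => \sum_i score p a b s (tnth x i) ^+ 2) (r := n%:R * I)); last first.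
    have := has_iint_sum (fun i : 'I_n => has_iint_coord h1 i hI).
    move=> /has_iint_ext; apply.
      by move=> x; rewrite /= mulr_suml.
    by rewrite sumr_const card_ord mulr_natl.
  rewrite (dens_int_tensor (G := fun x => ln (f x)) (r := n%:R * H)); last first.
    have := has_iint_sum (fun i : 'I_n => has_iint_coord h1 i hH).
    move=> /has_iint_ext; apply.
      move=> x; rewrite /= -mulr_suml; congr (_ * _).
      by rewrite ln_prod// => i; exact: mixture_ratio_gt0.
    by rewrite sumr_const card_ord mulr_natl.
  by rewrite -EFinM -EFinB; congr EFin; ring.
- have lnV : - (2 * ln s) <= s ^- 2 - 1.
    have : -1 < s ^- 2 - 1 by rewrite ltrBrDr addNr invr_gt0 exprn_gt0.
    move=> /le_ln1Dx; rewrite addrCA subrr addr0 lnV ?posrE ?exprn_gt0//.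
    by rewrite lnXn// mulr_natl.
  have kE : (1 - s ^+ 2) ^+ 2 / s ^+ 2 = s ^- 2 - 1 - (1 - s ^+ 2).
    by field; rewrite ?gt_eqF.
  have eE : (a - b) ^+ 2 / (2 * s ^+ 4) = 2 * ((a - b) ^+ 2 / (4 * s ^+ 4)).
    by field; rewrite ?gt_eqF.
  move: lI uH; rewrite kE eE; set w := _ / (4 * _); set e := _ * expR _.
  by move=> lI uH; lra.
- have ls : 2 * ln s <= s ^+ 2 - 1.
    have : -1 < s ^+ 2 - 1 by rewrite ltrBrDr addNr exprn_gt0.
    by move=> /le_ln1Dx; rewrite addrCA subrr addr0 lnXn// mulr_natl.
  have kE : (1 - s ^+ 2) ^+ 2 / (2 * s ^+ 2) = (1 - s ^+ 2) ^+ 2 / s ^+ 2 / 2.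
    by field; rewrite ?gt_eqF.
  move: uI lH; rewrite kE; set w := _ / s ^+ 2 => uI lH; lra.
Qed.

Lemma dens_meas_coord i (B : set R) : measurable B ->
  dens_meas f ((fun x => tnth x i) @^-1` B) = (\int[mu]_(x in B) (rho x)%:E)%E.
Proof.
move=> mB; have h1 := has_integral_mixture1 p a b s.
rewrite -(leb_iint_coord (n := n) i (rho := fun _ => rho))//; last first.
  by move=> _ x; rewrite ltW// mixture_gt0.
rewrite -leb_int_ge0E; last first.
  move=> x; rewrite lee_fin mulr_ge0// prodr_ge0// => j _.
  by rewrite ltW// mixture_gt0.
congr leb_int; apply/funext => x; rewrite -EFinM -mulrA tensor_gauss_dens//.
Qed.

Lemma gaussian_coord i (m : n.-tuple R) (B : set R) : measurable B ->
  gaussian m ((fun x => tnth x i) @^-1` B) =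
  (\int[mu]_(x in B) (normal_pdf (tnth m i) 1 x)%:E)%E.
Proof.
move=> mB.
rewrite -(leb_iint_coord (n := n) i (rho := fun j => normal_pdf (tnth m j) 1))//.
- by congr leb_iint; apply/funext => x; rewrite gauss_densE.
- by move=> j; exact: has_integral_normal.
- by move=> j x; rewrite normal_pdf_ge0.
Qed.

End TensorMixture.

Lemma dens_meas_mixture1 {R : realType} (p : R) (a b : R) (A : set (1.-tuple R)) :
  0 < p -> p < 1 -> measurable A ->
  dens_meas (tensor (mixture_ratio p a b 1)) A =
  (p%:E * gaussian [tuple a] A + (1 - p)%:E * gaussian [tuple b] A)%E.
Proof.
move=> p0 p1 mA.
rewrite /dens_meas /gint leb_int_ge0E; last first.
  move=> x; rewrite -EFinM lee_fin -mulrA tensor_gauss_dens ?ltr01//.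
  by rewrite mulr_ge0// prodr_ge0// => j _; rewrite ltW// mixture_gt0.
have mI : measurable_fun setT (\1_A : 1.-tuple R -> R) by exact: measurable_indic.
have mg (c : 1.-tuple R) : measurable_fun setT (fun x => (\1_A x * gauss_dens c x)%:E).
  apply/measurable_EFinP; apply: measurable_funM => //.
  rewrite (_ : gauss_dens c = fun x => \prod_i normal_pdf (tnth c i) 1 (tnth x i)); last first.
    by apply/funext => x; exact: gauss_densE.
  apply: measurable_prod => i _.
  by apply: measurableT_comp; [exact: measurable_normal_pdf|exact: measurable_tnth].
have g0 (c x : 1.-tuple R) : (0 <= (\1_A x * gauss_dens c x)%:E)%E.
  rewrite lee_fin mulr_ge0// gauss_densE prodr_ge0// => i _; exact: normal_pdf_ge0.
rewrite /gaussian -!leb_iintZ ?subr_ge0 ?ltW// -leb_iintD//; last 4 first.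
- exact: measurable_funeM.
- by move=> z; rewrite mule_ge0// lee_fin ltW.
- exact: measurable_funeM.
- by move=> z; rewrite mule_ge0// lee_fin subr_ge0 ltW.
congr leb_iint; apply/funext => x.
rewrite -!EFinM -EFinD; congr EFin; rewrite -mulrA tensor_gauss_dens ?ltr01//.
rewrite !gauss_densE /tensor !big_ord1 /mixture /= !(tnth_nth 0)/=.
by ring.
Qed.

(** * Lower bounds on transport costs *)

Section Tests.
Context {R : realType}.
Local Notation mu := (@lebesgue_measure R).
Implicit Types (Phi : R -> R) (a m s T x y : R).

(** Jensen's inequality at the mean: the supporting line integrates to [Phi a] because the centered
    first moment vanishes. An infinite integral is treated apart. *)
Lemma normal_supporting_line Phi a s c : 0 < s -> measurable_fun setT Phi ->
  (forall x, 0 <= Phi x) -> (forall x, Phi a + c * (x - a) <= Phi x) ->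
  ((Phi a)%:E <= \int[mu]_x (Phi x * normal_pdf a s x)%:E)%E.
Proof.
move=> s0 mPhi Phi0 tangent; have N0 x := normal_pdf_ge0 a s x.
have mf : measurable_fun setT (fun x => Phi x * normal_pdf a s x).
  by apply: measurable_funM => //; exact: measurable_normal_pdf.
have f0 x : 0 <= Phi x * normal_pdf a s x by rewrite mulr_ge0.
have [fty|] := ltP (\int[mu]_x (Phi x * normal_pdf a s x)%:E)%E +oo%E; last first.
  by rewrite leye_eq => /eqP ->; rewrite leey.
have fi : mu.-integrable setT (EFin \o (fun x => Phi x * normal_pdf a s x)).
  apply/integrableP; split; first exact/measurable_EFinP.
  by under eq_integral do rewrite /= ger0_norm//.
have fI : has_integral (fun x => Phi x * normal_pdf a s x)
    (fine (\int[mu]_x (Phi x * normal_pdf a s x)%:E)%E).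
  by split => //; rewrite fineK//; exact: (integrable_fin_num _ fi).
rewrite fI.2 lee_fin.
have tI := has_integralD (has_integralZ (Phi a) (has_integral_normal a s))
  (has_integralZ c (has_integral_normal_centered a s0)).
rewrite mulr1 mulr0 addr0 in tI; apply: has_integral_le tI fI _ => x.
by rewrite mulrA -mulrDl ler_wpM2r.
Qed.

(** The mixture is at least one of its weighted components, to which Jensen's inequality applies;
    [w] and [z] are the weight and the atom of that component. *)
Lemma mixture_supporting_line (Phi : R -> R) (p a b s c w z : R) : 0 < p -> p < 1 -> 0 < s ->
  (w = p /\ z = a) \/ (w = 1 - p /\ z = b) ->
  measurable_fun setT Phi ->
  (forall x, 0 <= Phi x) -> (forall x, Phi z + c * (x - z) <= Phi x) ->
  ((w * Phi z)%:E <= \int[mu]_x (Phi x * mixture p a b s x)%:E)%E.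
Proof.
move=> p0 p1 s0 wz mPhi Phi0 tangent.
have w0 : 0 <= w by case: wz => -[-> _]; rewrite ?subr_ge0 ltW.
have mN e : measurable_fun setT (fun x => Phi x * normal_pdf e s x).
  by apply: measurable_funM => //; exact: measurable_normal_pdf.
apply: (@le_trans _ _ (\int[mu]_x (w%:E * (Phi x * normal_pdf z s x)%:E))%E).
  rewrite ge0_integralZl ?lee_fin//; last 2 first.
  - apply/measurable_EFinP; exact: mN.
  - by move=> x _; rewrite lee_fin mulr_ge0// normal_pdf_ge0.
  by rewrite EFinM lee_wpmul2l// (normal_supporting_line (c := c)).
apply: ge0_le_integral => //.
- by move=> x _; rewrite -EFinM lee_fin !mulr_ge0// normal_pdf_ge0.
- by apply: measurable_funeM; apply/measurable_EFinP; exact: mN.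
- by apply/measurable_EFinP; apply: measurable_funM => //; exact: measurable_mixture.
- move=> x _; rewrite -EFinM lee_fin mulrCA ler_wpM2l// /mixture.
  by case: wz => -[-> ->]; rewrite ?lerDl ?lerDr mulr_ge0 ?normal_pdf_ge0// ?subr_ge0 ltW.
Qed.

(** For [T >= 0], the distance from [x] to [[-T, T]]. Its square replaces [x^2] as test function for
    the quadratic cost: the quantity to detect per coordinate is far below the unit variance of the
    Gaussian, while [excess] has an exponentially small second moment there. *)
Definition excess (T x : R) : R := Num.max (`|x| - T) 0.

Lemma excess_ge0 T x : 0 <= excess T x.
Proof. by rewrite le_max lexx orbT. Qed.

Lemma measurable_excess T m : measurable_fun setT (fun x => excess T (x - m)).
Proof.
apply: measurable_maxr => //; apply: measurable_funB => //.
by apply: measurableT_comp => //; exact: measurable_funB.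
Qed.

(** With [U] and [q] the excesses at [a] and [x], the line is at most
    [U^2 + 2 U (q - U) = q^2 - (q - U)^2]. *)
Lemma excess_supporting_line T m a x : T <= `|a - m| ->
  excess T (a - m) ^+ 2 +
    2 * Num.sg (a - m) * (`|a - m| - T) * (x - a) <= excess T (x - m) ^+ 2.
Proof.
move=> Ta; rewrite {1}/excess max_l ?subr_ge0//.
have : Num.sg (a - m) * (x - a) <= `|x - m| - `|a - m|.
  have -> : x - a = (x - m) - (a - m) by ring.
  rewrite mulrBr -normrEsg lerD2r (le_trans (ler_norm _))// normrM.
  by rewrite ler_piMl// normr_sg lern1; case: (_ != 0).
set e := Num.sg _ * _ => he.
have -> : 2 * Num.sg (a - m) * (`|a - m| - T) * (x - a) = 2 * (`|a - m| - T) * e.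
  by rewrite /e; ring.
set U := `|a - m| - T in he *; have U0 : 0 <= U by rewrite subr_ge0.
have eU : e <= (`|x - m| - T) - U by rewrite /U; lra.
have := excess_ge0 T (x - m); have : `|x - m| - T <= excess T (x - m).
  by rewrite le_max lexx.
move: (excess _ _) => q wq q0.
have : U * e <= U * (q - U) by rewrite ler_wpM2l//; lra.
by have := sqr_ge0 (q - U); lra.
Qed.

Lemma norm_supporting_line m a x : `|a - m| + Num.sg (a - m) * (x - a) <= `|x - m|.
Proof.
have -> : `|a - m| + Num.sg (a - m) * (x - a) = Num.sg (a - m) * (x - m).
  by rewrite [in LHS]normrEsg; ring.
rewrite (le_trans (ler_norm _))// normrM.
by rewrite ler_piMl// normr_sg lern1; case: (_ != 0).
Qed.

Lemma expR_norm_le x : expR `|x| <= expR x + expR (- x).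
Proof.
by have := expR_ge0 x; have := expR_ge0 (- x); case: (ger0P x); lra.
Qed.

(** Tilting [N(m, 1)] by [e^(x - m)] or [e^(m - x)] gives [e^(1/2)] times the Gaussian shifted by 1
    or by -1. *)
Lemma has_integral_normal_expR m : has_integral
  (fun x => (expR (x - m) + expR (- (x - m))) * normal_pdf m 1 x) (2 * expR 2^-1).
Proof.
have h e : e ^+ 2 = 1 -> has_integral (fun x => expR (e * (x - m)) * normal_pdf m 1 x) (expR 2^-1).
  move=> e1; apply: has_integral_ext (has_integralZ (expR 2^-1)
    (has_integral_normal (m + e) 1)) _ _; last by rewrite mulr1.
  move=> x; rewrite (normal_pdf_change (m + e) m x ltr01 ltr01) divr1 mul1r mulrCA mulrC.
  rewrite -expRD; congr (expR _ * _).
  have -> : (2^-1 : R) = e ^+ 2 / 2 by rewrite e1 mul1r.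
  by field.
apply: has_integral_ext (has_integralD (h 1 _) (h (-1) _)) _ _.
- by rewrite expr1n.
- by rewrite sqrrN expr1n.
- by move=> x; rewrite mul1r mulN1r mulrDl.
- by ring.
Qed.

Lemma normal_expR_bound m k Phi : 0 <= k -> measurable_fun setT Phi ->
  (forall x, 0 <= Phi x) -> (forall x, Phi x <= k * expR `|x - m|) ->
  (\int[mu]_x (Phi x * normal_pdf m 1 x)%:E <= (k * (2 * expR 2^-1))%:E)%E.
Proof.
move=> k0 mPhi Phi0 Phik; have := has_integralZ k (has_integral_normal_expR m).
move=> [ki <-]; apply: ge0_le_integral => //.
- by move=> x _; rewrite lee_fin mulr_ge0// normal_pdf_ge0.
- apply/measurable_EFinP; apply: measurable_funM => //; exact: measurable_normal_pdf.
- exact: measurable_int ki.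
- move=> x _; rewrite lee_fin mulrA ler_wpM2r ?normal_pdf_ge0//.
  by rewrite (le_trans (Phik x))// ler_wpM2l// expR_norm_le.
Qed.

(** Outside [[-T, T]], this is [y^2 / 2 <= e^y] at [y = |x| - T]. *)
Lemma excess_le_expR T x : excess T x ^+ 2 <= 2 * expR (- T) * expR `|x|.
Proof.
rewrite /excess -mulrA -expRD [- T + _]addrC; case: (leP (`|x| - T) 0) => h.
  by rewrite expr0n/= mulr_ge0 ?expR_ge0.
have := expR_ge1Dxn 1 (ltW h); rewrite -[2`!]/2%N; lra.
Qed.

Lemma norm_le_expR x : `|x| <= 1 * expR `|x|.
Proof. by have := expR_ge1Dx `|x|; lra. Qed.

End Tests.

(** * Bounds valid for every coupling, one coordinate at a time *)

Section Couplings.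
Context {R : realType}.
Local Notation mu := (@lebesgue_measure R).
Variables (n : nat) (p a b s : R) (m : n.-tuple R).
Hypotheses (p0 : 0 < p) (p12 : p <= 1 - p) (s0 : 0 < s).
Local Notation f := (tensor (mixture_ratio p a b s) : n.-tuple R -> R).
Variable P : probability (n.-tuple R * n.-tuple R)%type R.
Hypothesis cpl : coupling (dens_meas f) (gaussian m) P.
Local Notation crdl i z := (tnth z.1 i).
Local Notation crdr i z := (tnth z.2 i).

Let p1 : p < 1. Proof. by rewrite (le_lt_trans p12)// gtrBl. Qed.

Let mtn i : measurable_fun setT (fun x : n.-tuple R => tnth x i).
Proof. exact: measurable_tnth. Qed.

Let mX i : measurable_fun setT (fun z : n.-tuple R * n.-tuple R => crdl i z).
Proof. by apply: (measurableT_comp (mtn i)). Qed.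

Let mY i : measurable_fun setT (fun z : n.-tuple R * n.-tuple R => crdr i z).
Proof. by apply: (measurableT_comp (mtn i)). Qed.

Let measurable_coord i B : measurable B ->
  measurable ((fun x : n.-tuple R => tnth x i) @^-1` B).
Proof. by move=> mB; rewrite -[X in measurable X]setTI; exact: mtn. Qed.

Lemma coupling_fst i (Phi : R -> R) : measurable_fun setT Phi -> (forall x, 0 <= Phi x) ->
  (\int[P]_z (Phi (crdl i z))%:E = \int[mu]_x (Phi x * mixture p a b s x)%:E)%E.
Proof.
apply: (integral_law (X := fun z : n.-tuple R * n.-tuple R => crdl i z)) => //.
- exact: measurable_mixture.
- by move=> x; rewrite ltW// mixture_gt0.
- by move=> B mB; have [h _] := cpl (measurable_coord i mB); apply: etrans h _; exact: dens_meas_coord.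
Qed.

Lemma coupling_snd i (Phi : R -> R) : measurable_fun setT Phi -> (forall x, 0 <= Phi x) ->
  (\int[P]_z (Phi (crdr i z))%:E = \int[mu]_x (Phi x * normal_pdf (tnth m i) 1 x)%:E)%E.
Proof.
apply: (integral_law (X := fun z : n.-tuple R * n.-tuple R => crdr i z)) => //.
- exact: measurable_normal_pdf.
- exact: normal_pdf_ge0.
- by move=> B mB; have [_ h] := cpl (measurable_coord i mB); apply: etrans h _; exact: gaussian_coord.
Qed.

(** By the triangle inequality [t] cannot be within half the gap of both atoms; since [p <= 1 - p],
    either atom weighs at least [p]. *)
Lemma far_atom (t : R) : exists w z, [/\ (w = p /\ z = a) \/ (w = 1 - p /\ z = b),
  p <= w & `|a - b| / 2 <= `|z - t|].
Proof.
have : `|a - b| <= `|a - t| + `|b - t|.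
  by rewrite (distrC b t) (le_trans _ (ler_normD _ _))// addrA subrK.
have [ha _|ha hb] := leP (`|a - b| / 2) `|a - t|.
  by exists p, a; split => //; left.
by exists (1 - p), b; split => //; [right|lra].
Qed.

(** As [excess T] is 1-Lipschitz, half its square at one point is at most the squared distance plus
    its square at the other. The far atom bounds the mixture side from below, and the exponential
    moment bounds the Gaussian side by [4 e^(1/2) e^(-T)]. *)
Lemma coupling_sq_ge i (T : R) : 0 <= T <= `|a - b| / 2 ->
  ((p / 2 * (`|a - b| / 2 - T) ^+ 2 - 4 * expR 2^-1 * expR (- T))%:E <=
   \int[P]_z ((crdl i z - crdr i z) ^+ 2)%:E)%E.
Proof.
move=> /andP[T0 TD]; set t := tnth m i.
have [w [z [wz pw zt]]] := far_atom t.
pose Phi x := excess T (x - t) ^+ 2.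
have mPhi : measurable_fun setT Phi by apply: measurable_funX; exact: measurable_excess.
have Phi0 x : 0 <= Phi x by exact: sqr_ge0.
have lo : ((p * (`|a - b| / 2 - T) ^+ 2)%:E <= \int[P]_z (Phi (crdl i z))%:E)%E.
  rewrite coupling_fst//; apply: le_trans.
    2: exact: (mixture_supporting_line p0 p1 s0 wz mPhi Phi0
      (fun x => excess_supporting_line x (le_trans TD zt))).
  rewrite lee_fin ler_pM ?(ltW p0) ?sqr_ge0//.
  rewrite /Phi /excess max_l ?subr_ge0 ?(le_trans TD)//.
  by rewrite lerXn2r ?nnegrE ?subr_ge0 ?lerD2r ?(le_trans TD).
have up : (\int[P]_z (Phi (crdr i z))%:E <= (2 * expR (- T) * (2 * expR 2^-1))%:E)%E.
  rewrite coupling_snd//; apply: normal_expR_bound => //.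
  by move=> x; exact: excess_le_expR.
have mPX : measurable_fun setT (fun z : n.-tuple R * n.-tuple R => Phi (crdl i z)).
  exact: measurableT_comp.
have mPY : measurable_fun setT (fun z : n.-tuple R * n.-tuple R => Phi (crdr i z)).
  exact: measurableT_comp.
have mD : measurable_fun setT (fun z : n.-tuple R * n.-tuple R => (crdl i z - crdr i z) ^+ 2).
  by apply: measurable_funX; exact: measurable_funB.
have le : (\int[P]_z (2^-1%:E * (Phi (crdl i z))%:E) <=
    \int[P]_z (((crdl i z - crdr i z) ^+ 2)%:E + (Phi (crdr i z))%:E))%E.
  apply: ge0_le_integral => //.
  - by move=> v _; rewrite -EFinM lee_fin mulr_ge0.
  - by apply: measurable_funeM; exact/measurable_EFinP.
  - by apply: emeasurable_funD; exact/measurable_EFinP.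
  move=> v _; rewrite -EFinM -EFinD lee_fin /Phi.
  set x := crdl i v; set y := crdr i v.
  have : excess T (x - t) <= `|x - y| + excess T (y - t).
    rewrite ge_max addr_ge0 ?excess_ge0// andbT lerBlDr.
    have h1 : `|x - t| <= `|x - y| + `|y - t|.
      by rewrite (le_trans _ (ler_normD _ _))// addrA subrK.
    have h2 : `|y - t| - T <= excess T (y - t) by rewrite le_max lexx.
    by lra.
  have := excess_ge0 T (x - t); have := excess_ge0 T (y - t).
  rewrite -[(x - y) ^+ 2](real_normK) ?num_real//; have := normr_ge0 (x - y).
  move: (excess T _) (excess T _) `|_| => B A C C0 A0 B0 ABC.
  have : B ^+ 2 <= (C + A) ^+ 2 by rewrite lerXn2r ?nnegrE ?addr_ge0.
  by have := sqr_ge0 (C - A); lra.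
have mDE := (measurable_EFinP _ _).2 mD.
have mPXE := (measurable_EFinP _ _).2 mPX.
have mPYE := (measurable_EFinP _ _).2 mPY.
rewrite (ge0_integralD _ measurableT _ mDE _ mPYE) in le;
  [|by move=> v _; rewrite lee_fin ?sqr_ge0..].
rewrite (ge0_integralZl _ measurableT mPXE) in le; 
  [|by move=> v _; rewrite lee_fin|by rewrite lee_fin invr_ge0].
have lo2 : ((p / 2 * (`|a - b| / 2 - T) ^+ 2)%:E <=
   2^-1%:E * \int[P]_z (Phi (crdl i z))%:E)%E.
  apply: (@le_trans _ _ (2^-1%:E * (p * (`|a - b| / 2 - T) ^+ 2)%:E)%E).
    by rewrite -EFinM lee_fin; lra.
  by apply: lee_wpmul2l.
rewrite EFinB leeBlDr//; apply: le_trans lo2 _; apply: le_trans le _.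
apply: leeD => //; apply: le_trans up _; rewrite lee_fin; lra.
Qed.

(** Same scheme with the 1-Lipschitz test function [|x - t|], whose Gaussian mean is only bounded by
    a constant. *)
Lemma coupling_norm_ge i :
  ((p * (`|a - b| / 2) - 2 * expR 2^-1)%:E <= \int[P]_z (`|crdl i z - crdr i z|)%:E)%E.
Proof.
set t := tnth m i.
have [w [z [wz pw zt]]] := far_atom t.
pose Phi x := `|x - t|.
have mPhi : measurable_fun setT Phi.
  by apply: measurableT_comp => //; exact: measurable_funB.
have Phi0 x : 0 <= Phi x by exact: normr_ge0.
have lo : ((p * (`|a - b| / 2))%:E <= \int[P]_z (Phi (crdl i z))%:E)%E.
  rewrite coupling_fst//; apply: le_trans.
    2: exact: (mixture_supporting_line p0 p1 s0 wz mPhi Phi0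
      (norm_supporting_line t z)).
  by rewrite lee_fin ler_pM ?(ltW p0) ?divr_ge0.
have up : (\int[P]_z (Phi (crdr i z))%:E <= (1 * (2 * expR 2^-1))%:E)%E.
  rewrite coupling_snd//; apply: normal_expR_bound => // x.
  exact: norm_le_expR.
have mPX : measurable_fun setT (fun z : n.-tuple R * n.-tuple R => Phi (crdl i z)).
  exact: measurableT_comp.
have mPY : measurable_fun setT (fun z : n.-tuple R * n.-tuple R => Phi (crdr i z)).
  exact: measurableT_comp.
have mD : measurable_fun setT (fun z : n.-tuple R * n.-tuple R => `|crdl i z - crdr i z|).
  by apply: measurableT_comp => //; exact: measurable_funB.
have le : (\int[P]_z (Phi (crdl i z))%:E <=
    \int[P]_z ((`|crdl i z - crdr i z|)%:E + (Phi (crdr i z))%:E))%E.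
  apply: ge0_le_integral => //.
  - by move=> v _; rewrite lee_fin.
  - exact/measurable_EFinP.
  - by apply: emeasurable_funD; exact/measurable_EFinP.
  move=> v _; rewrite -EFinD lee_fin /Phi.
  by rewrite (le_trans _ (ler_normD _ _))// addrA subrK.
have mDE := (measurable_EFinP _ _).2 mD.
have mPYE := (measurable_EFinP _ _).2 mPY.
rewrite (ge0_integralD _ measurableT _ mDE _ mPYE) in le;
  [|by move=> v _; rewrite lee_fin ?sqr_ge0..].
rewrite EFinB leeBlDr//; apply: le_trans lo _; apply: le_trans le _.
by apply: leeD => //; rewrite -[2 * _]mul1r.
Qed.

End Couplings.

(** * From couplings to Wasserstein distances *)

Section Wasserstein.
Context {R : realType}.

(** The squared Euclidean cost is the sum of the squared coordinate costs, so a bound [c] for each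
    coordinate yields [n c] before taking the root. *)
Lemma wasserstein2_ge n (mu nu : set (n.-tuple R) -> \bar R) (c t : R) :
  0 <= t -> t ^+ 2 <= n%:R * c ->
  (forall P : probability (n.-tuple R * n.-tuple R)%type R, coupling mu nu P ->
    forall i, (c%:E <= \int[P]_z ((tnth z.1 i - tnth z.2 i) ^+ 2)%:E)%E) ->
  (t%:E <= wasserstein 2 mu nu)%E.
Proof.
move=> t0 tc h; apply: le_ereal_inf_tmp => _ [P cpl <-].
have lo : ((t ^+ 2)%:E <= \int[P]_z (Defs.edist z.1 z.2 `^ 2)%:E)%E.
  have E (x y : n.-tuple R) : (Defs.edist x y `^ 2)%:E =
      (\sum_(i < n) ((tnth x i - tnth y i) ^+ 2)%:E)%E.
    rewrite sumEFin powR_mulrn ?sqrtr_ge0// sqr_sqrtr//.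
    by apply: sumr_ge0 => i _; exact: sqr_ge0.
  under eq_integral do rewrite E.
  rewrite ge0_integral_sum//; last 2 first.
  - move=> i; apply/measurable_EFinP; apply: measurable_funX; apply: measurable_funB.
      by apply: (measurableT_comp (measurable_tnth i)).
    by apply: (measurableT_comp (measurable_tnth i)).
  - by move=> i z _; rewrite lee_fin sqr_ge0.
  apply: (@le_trans _ _ (\sum_(i < n) c%:E)%E).
    by rewrite sumEFin lee_fin sumr_const card_ord -mulr_natl.
  by apply: lee_sum => i _; exact: h.
have -> : t%:E = ((t ^+ 2)%:E `^ 2^-1)%E.
  by rewrite poweR_EFin powR12_sqrt ?sqr_ge0// sqrtr_sqr ger0_norm.
apply: gt0_ler_poweR => //.
- by rewrite in_itv/= lee_fin sqr_ge0 leey.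
- by rewrite in_itv/= leey andbT; apply: le_trans lo; rewrite lee_fin sqr_ge0.
Qed.

Lemma wasserstein1_ge (mu nu : set (1.-tuple R) -> \bar R) (c : R) :
  (forall P : probability (1.-tuple R * 1.-tuple R)%type R, coupling mu nu P ->
    forall i, (c%:E <= \int[P]_z (`|tnth z.1 i - tnth z.2 i|)%:E)%E) ->
  (c%:E <= wasserstein 1 mu nu)%E.
Proof.
move=> h; apply: le_ereal_inf_tmp => _ [P cpl <-].
rewrite invr1 poweRe1; last by apply: integral_ge0 => z _; rewrite lee_fin powR_ge0.
have E (x y : 1.-tuple R) : (Defs.edist x y `^ 1)%:E = (`|tnth x ord0 - tnth y ord0|)%:E.
  by rewrite powRr1 ?sqrtr_ge0// /Defs.edist big_ord1 sqrtr_sqr.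
by under eq_integral do rewrite E; exact: h.
Qed.

End Wasserstein.

(** * Explicit deficit bounds for the weight [r^-2] *)

Section Family.
Context {R : realType}.

Lemma inv_expR_le (y : R) : 0 < y -> expR (- y) <= y^-1.
Proof.
move=> y0; rewrite expRN lef_pV2 ?posrE ?expR_gt0//.
by have := expR_ge1Dx y; lra.
Qed.

(** With [p = r^-2], the first term is [2 ln r / r^2], at most [2 / r]; the second is at most [p],
    hence at most [1 / r]. *)
Lemma binary_entropy_le (r : R) : 1 < r ->
  - (r ^- 2 * ln (r ^- 2) + (1 - r ^- 2) * ln (1 - r ^- 2)) <= 3 / r.
Proof.
move=> r1; have r0 : 0 < r by lra.
have p1 : r ^- 2 < 1 by rewrite invf_lt1 ?exprn_gt0// expr_gt1//; lra.
have h1 : - (r ^- 2 * ln (r ^- 2)) <= 2 / r.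
  have lr : ln r <= r.
    have : -1 < r - 1 by lra.
    by move=> /le_ln1Dx; rewrite addrCA subrr addr0; lra.
  rewrite lnV ?posrE ?exprn_gt0// lnXn// mulrN opprK -[ln r *+ 2]mulr_natl.
  have -> : 2 / r = r ^- 2 * (2 * r) by field; rewrite ?gt_eqF.
  by rewrite ler_pM2l ?invr_gt0 ?exprn_gt0//; lra.
have h2 : - ((1 - r ^- 2) * ln (1 - r ^- 2)) <= 1 / r.
  set p := r ^- 2 in p1 *; have q0 : 0 < 1 - p by lra.
  have : -1 < (1 - p)^-1 - 1 by rewrite ltrBrDr addNr invr_gt0.
  move=> /le_ln1Dx; rewrite addrCA subrr addr0 lnV ?posrE// -(ler_pM2l q0).
  have -> : (1 - p) * ((1 - p)^-1 - 1) = p by field; rewrite ?gt_eqF.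
  rewrite mulrN => /le_trans; apply; rewrite /p mul1r.
  by rewrite lef_pV2 ?posrE ?exprn_gt0// expr2 ler_peMr// ltW.
have -> : 3 / r = 2 / r + 1 / r by field; rewrite ?gt_eqF.
by lra.
Qed.

(** Applying [e^(-y) <= 1 / y] to the overlap term cancels its factor [(a - b)^2], so the bound no
    longer involves the gap between the atoms, which can be taken as large as needed. *)
Lemma lsdeficit_tensor_le n (r a b s : R) : 1 < r -> a != b -> 0 < s -> exists D : R,
  lsdeficit (tensor (mixture_ratio (r ^- 2) a b s) : n.-tuple R -> R) = (n%:R * D)%:E /\
  `|D| <= (1 - s ^+ 2) ^+ 2 / (2 * s ^+ 2) + 3 / r + 2 / (r * s ^+ 2).
Proof.
move=> r1 ab s0; have r0 : 0 < r by lra.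
have p0 : 0 < r ^- 2 by rewrite invr_gt0 exprn_gt0.
have p1 : r ^- 2 < 1 by rewrite invf_lt1 ?exprn_gt0// expr_gt1//; lra.
have [D [DE lD uD]] := lsdeficit_tensor n a b p0 p1 s0.
exists D; split => //.
have H := binary_entropy_le r1.
have sp : Num.sqrt (r ^- 2) = r^-1.
  by rewrite -exprVn sqrtr_sqr gtr0_norm ?invr_gt0.
have d0 : 0 < (a - b) ^+ 2 by rewrite exprn_even_gt0// subr_eq0.
have E : (a - b) ^+ 2 / (4 * s ^+ 4) *
    (Num.sqrt (r ^- 2) * expR (- (a - b) ^+ 2 / (8 * s ^+ 2))) <= 2 / (r * s ^+ 2).
  have y0 : 0 < (a - b) ^+ 2 / (8 * s ^+ 2) by rewrite divr_gt0// mulr_gt0// exprn_gt0.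
  have := inv_expR_le y0; rewrite sp mulNr => le.
  have -> : 2 / (r * s ^+ 2) = (a - b) ^+ 2 / (4 * s ^+ 4) *
      (r^-1 * ((a - b) ^+ 2 / (8 * s ^+ 2))^-1).
    by move: ((a - b) ^+ 2) d0 => d d0; field; rewrite ?gt_eqF.
  by rewrite !ler_pM2l ?invr_gt0// divr_gt0// mulr_gt0// exprn_gt0.
have k0 : 0 <= (1 - s ^+ 2) ^+ 2 / (2 * s ^+ 2).
  by rewrite divr_ge0 ?sqr_ge0// mulr_ge0// sqr_ge0.
have r3 : 0 <= 3 / r by rewrite divr_ge0// ltW.
have r2 : 0 <= 2 / (r * s ^+ 2) by rewrite divr_ge0// mulr_ge0 ?sqr_ge0// ltW.
by rewrite ler_norml; apply/andP; split; lra.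
Qed.

End Family.

(** * Choice of the parameters *)

Section Rates.
Context {R : realType}.
Variable N : R.
Hypothesis N2 : 2 <= N.

Let N0 : 0 < N. Proof. by rewrite (lt_le_trans _ N2). Qed.
Let NN0 : N != 0. Proof. by rewrite gt_eqF. Qed.

Lemma exp_ge2 k : 2 <= N ^+ k.+1.
Proof.
rewrite exprS (le_trans N2)// ler_peMr ?(ltW N0)// exprn_ege1// (le_trans _ N2)//.
by rewrite ler1n.
Qed.

(* Mixtures [p N((1 - p) D, s^2) + (1 - p) N(- p D, s^2)], centered by construction,
   with [p = r^-2]. *)
Lemma centered_atoms (p D : R) :
  [/\ p * ((1 - p) * D) + (1 - p) * (- p * D) = 0,
      p * ((1 - p) * D) ^+ 2 + (1 - p) * (- p * D) ^+ 2 = p * (1 - p) * D ^+ 2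
    & (1 - p) * D - - p * D = D].
Proof. by split; ring. Qed.

Lemma weight_bounds k : let p := (N ^+ k.+1) ^- 2 in [/\ 0 < p, p < 1 & p <= 1 - p].
Proof.
move=> p; have Nk := exp_ge2 k; have Nk0 : 0 < N ^+ k.+1 by lra.
have p0 : 0 < p by rewrite invr_gt0 exprn_gt0.
have : p <= 4^-1 by rewrite lef_pV2 ?posrE ?exprn_gt0//; nra.
by move=> p4; split => //; lra.
Qed.

(* Excess variance [p (1 - p) D^2] for [r = N^8] and [D = N^6]. *)
Let eps := (N ^+ 8) ^- 2 * (1 - (N ^+ 8) ^- 2) * (N ^+ 6) ^+ 2.

Lemma eps_bounds : 0 < eps /\ eps <= N ^- 4.
Proof.
have [p0 p1 _] := weight_bounds 7; split.
  by rewrite !mulr_gt0 ?subr_gt0 ?exprn_gt0.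
have -> : N ^- 4 = (N ^+ 8) ^- 2 * (N ^+ 6) ^+ 2 by field.
rewrite /eps mulrAC ler_piMr//; last lra.
by rewrite mulr_ge0 ?exprn_ge0 ?ltW.
Qed.

(** The components are narrowed so that adding the spread [eps] of the atoms restores variance 1. *)
Definition stdev := Num.sqrt (1 - eps).

Lemma inv4_le : N ^- 4 <= 16^-1.
Proof.
rewrite lef_pV2 ?posrE ?exprn_gt0//.
have -> : 16 = 2 ^+ 4 :> R by ring.
by rewrite lerXn2r ?nnegrE ?(ltW N0).
Qed.

Lemma stdev_sq : stdev ^+ 2 = 1 - eps.
Proof.
have [_ e4] := eps_bounds; have := inv4_le => n4.
by rewrite sqr_sqrtr//; lra.
Qed.

Lemma stdev_gt0 : 0 < stdev.
Proof.
have [_ e4] := eps_bounds; have := inv4_le => n4.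
by rewrite sqrtr_gt0; lra.
Qed.

(** The three terms are at most 1, 3 and 4 times [N^-8], where [eps <= 1/2] absorbs the factor
    [1 - eps]. *)
Lemma deficit_rate (D : R) :
  `|D| <= (1 - stdev ^+ 2) ^+ 2 / (2 * stdev ^+ 2) + 3 / N ^+ 8 + 2 / (N ^+ 8 * stdev ^+ 2) ->
  N ^+ 6 * `|D| <= 8 * N ^- 2.
Proof.
have [e0 e4] := eps_bounds; have n4 := inv4_le; rewrite stdev_sq => DB.
have N8 : 0 < N ^+ 8 by rewrite exprn_gt0.
have h1 : (1 - (1 - eps)) ^+ 2 / (2 * (1 - eps)) <= 1 / N ^+ 8.
  have -> : 1 - (1 - eps) = eps by ring.
  have -> : 1 / N ^+ 8 = N ^- 4 ^+ 2 by field.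
  rewrite ler_pdivrMr; last lra.
  have : eps ^+ 2 <= N ^- 4 ^+ 2 by rewrite lerXn2r ?nnegrE ?invr_ge0 ?exprn_ge0// ?ltW.
  have : 0 <= N ^- 4 ^+ 2 * (1 - 2 * eps) by rewrite mulr_ge0 ?sqr_ge0//; lra.
  by lra.
have h2 : 2 / (N ^+ 8 * (1 - eps)) <= 4 / N ^+ 8.
  rewrite ler_pdivrMr ?mulr_gt0//; last lra.
  rewrite mulrA divfK ?gt_eqF//; lra.
have -> : 8 * N ^- 2 = N ^+ 6 * (8 / N ^+ 8) by field.
rewrite ler_pM2l ?exprn_gt0//; move: DB h1 h2.
rewrite -[3 / _]/(3 * _) -[4 / _]/(4 * _) -[1 / _]/(1 * _) -[8 / _]/(8 * _).
by lra.
Qed.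

(** The main term is [N^2 / 32] and the error at most [16 K]. From [1024 K <= N <= N^2] the error is
    at most [N^2 / 64], which leaves [(N / 8)^2]. *)
Lemma transport_rate (K : R) : 0 <= K -> 1024 * K <= N ->
  (N / 8) ^+ 2 <= N ^+ 6 * ((N ^+ 8) ^- 2 / 2 * (N ^+ 6 / 2 - N ^+ 6 / 4) ^+ 2
                  - 4 * K * expR (- (N ^+ 6 / 4))).
Proof.
move=> K0 KN; have N6 : 0 < N ^+ 6 by rewrite exprn_gt0.
have e := inv_expR_le (divr_gt0 N6 (ltr0n R 4)).
have h : N ^+ 6 * (4 * K * expR (- (N ^+ 6 / 4))) <= 16 * K.
  have -> : 16 * K = N ^+ 6 * (4 * K * (N ^+ 6 / 4)^-1) by field.
  by rewrite ler_pM2l// ler_wpM2l// mulr_ge0.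
have E : N ^+ 6 * ((N ^+ 8) ^- 2 / 2 * (N ^+ 6 / 2 - N ^+ 6 / 4) ^+ 2) = N ^+ 2 / 32.
  by field.
rewrite mulrBr E.
have : N <= N ^+ 2 by rewrite expr2 ler_peMr ?ltW// (lt_le_trans _ N2)// ltr1n.
by rewrite exprMn; lra.
Qed.

End Rates.

(** * The two sequences of measures *)

Section Sequences.
Context {R : realType}.
Variable k : nat.
Local Notation N := (k.+2%:R : R).

(** The index is shifted by two so that every term of both sequences satisfies the condition
    [2 <= N] of the rate estimates. *)
Lemma natr2_ge2 : 2 <= N.
Proof. by rewrite ler_nat. Qed.

Let N0 : 0 < N. Proof. exact: ltr0n. Qed.
Let N1 : 1 < N. Proof. by rewrite ltr1n. Qed.
Let K0 : 0 <= expR 2^-1 :> R. Proof. exact: expR_ge0. Qed.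

Definition density1 : 1.-tuple R -> R := tensor (mixture_ratio (N ^- 2)
  ((1 - N ^- 2) * N ^+ 3) (- N ^- 2 * N ^+ 3) 1).

Lemma weight1 : [/\ 0 < N ^- 2, N ^- 2 < 1 & N ^- 2 <= 1 - N ^- 2].
Proof. by have := weight_bounds natr2_ge2 0; rewrite expr1. Qed.

(** For [s = 1] the variance term vanishes; the entropy contributes [3 / N] and the overlap
    [2 / N]. *)
Lemma density1_deficit : exists D, lsdeficit density1 = D%:E /\ `|D| <= 5 / N.
Proof.
have [p0 p1 _] := weight1; have [_ _ dE] := centered_atoms (N ^- 2) (N ^+ 3).
have ab : (1 - N ^- 2) * N ^+ 3 != - N ^- 2 * N ^+ 3.
  by rewrite -subr_eq0 dE gt_eqF// exprn_gt0.
have [D [DE DB]] := lsdeficit_tensor_le 1 N1 ab ltr01.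
exists D; split; first by rewrite DE mul1r.
apply: le_trans DB _; rewrite expr1n subrr expr0n/= mul0r add0r mulr1 -mulrDl.
by rewrite -natrD.
Qed.

Lemma density1_wasserstein (m : 1.-tuple R) :
  ((N / 2 - 2 * expR 2^-1)%:E <=
   wasserstein 1 (dens_meas density1) (gaussian m))%E.
Proof.
have [p0 p1 p12] := weight1; have [_ _ dE] := centered_atoms (N ^- 2) (N ^+ 3).
apply: wasserstein1_ge => P cpl i.
have := coupling_norm_ge p0 p12 ltr01 cpl i.
rewrite dE ger0_norm ?exprn_ge0// (_ : N ^- 2 * (N ^+ 3 / 2) = N / 2)//.
by field; rewrite ?gt_eqF.
Qed.

Definition density6 : (k.+2 ^ 6).-tuple R -> R := tensor (mixture_ratio ((N ^+ 8) ^- 2)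
  ((1 - (N ^+ 8) ^- 2) * N ^+ 6) (- (N ^+ 8) ^- 2 * N ^+ 6) (stdev N)).

Lemma density6_isotropic : prob_density density6
  /\ (forall i, dens_int density6 (fun x => (tnth x i)%:E) = 0%E)
  /\ (forall i j, dens_int density6 (fun x => (tnth x i * tnth x j)%:E) = ((i == j)%:R)%:E).
Proof.
have N2 := natr2_ge2; have [p0 p1 _] := weight_bounds N2 7.
have s0 := stdev_gt0 N2.
have [mE vE _] := centered_atoms ((N ^+ 8) ^- 2) (N ^+ 6).
split; [|split].
- exact: prob_density_tensor.
- by move=> i; exact: dens_int_coord.
- by move=> i j; apply: dens_int_coordM => //; rewrite vE stdev_sq//; ring.
Qed.

Lemma density6_deficit : (`|lsdeficit density6| <= (8 * N ^- 2)%:E)%E.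
Proof.
have N2 := natr2_ge2; have [p0 p1 _] := weight_bounds N2 7.
have [_ _ dE] := centered_atoms ((N ^+ 8) ^- 2) (N ^+ 6).
have ab : (1 - (N ^+ 8) ^- 2) * N ^+ 6 != - (N ^+ 8) ^- 2 * N ^+ 6.
  by rewrite -subr_eq0 dE gt_eqF// exprn_gt0.
have r1 : 1 < N ^+ 8 by rewrite exprn_egt1.
have [D [DE DB]] := lsdeficit_tensor_le (k.+2 ^ 6) r1 ab (stdev_gt0 N2).
rewrite DE abse_EFin lee_fin normrM natrX ger0_norm ?exprn_ge0//.
exact: deficit_rate.
Qed.

Lemma density6_wasserstein (m : (k.+2 ^ 6).-tuple R) : 1024 * expR 2^-1 <= N ->
  ((N / 8)%:E <= wasserstein 2 (dens_meas density6) (gaussian m))%E.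
Proof.
move=> KN; have N2 := natr2_ge2; have [p0 p1 p12] := weight_bounds N2 7.
have [_ _ dE] := centered_atoms ((N ^+ 8) ^- 2) (N ^+ 6).
apply: wasserstein2_ge; first by rewrite divr_ge0.
  by rewrite natrX; exact: (transport_rate N2 K0 KN).
move=> P cpl i.
have N6 : 0 < N ^+ 6 by rewrite exprn_gt0.
(* The cutoff is half of the guaranteed distance [N^6 / 2] to the far atom, so the retained excess
   and the exponent are both of order [N^6]. *)
have := coupling_sq_ge p0 p12 (stdev_gt0 N2) cpl i (T := N ^+ 6 / 4).
by rewrite dE (ger0_norm (ltW N6)); apply; lra.
Qed.

End Sequences.

(** * Limits and asymptotic rates *)

Theorem theorem3 (R : realType) :
  (* (a) : measures on R = R^1, each a mixture of two Gaussians of variance 1 *)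
  (exists f : nat -> 1.-tuple R -> R,
     (forall k, prob_density (f k) /\
        exists (p : R) (a b : 1.-tuple R), 0 <= p <= 1 /\
          forall A : set (1.-tuple R), measurable A ->
            dens_meas (f k) A = (p%:E * gaussian a A + (1 - p)%:E * gaussian b A)%E)
     /\ (fun k => lsdeficit (f k)) @ \oo --> 0%E
     /\ (fun k => ereal_inf [set wasserstein 1 (dens_meas (f k)) (gaussian m)
                            | m in [set: 1.-tuple R]]) @ \oo --> +oo%E)
  /\
  (* (b) : isotropic measures on R^(n k), n k increasing to +oo *)
  (exists (nk : nat -> nat) (f : forall k : nat, (nk k).-tuple R -> R),
     {homo nk : a b / (a <= b)%N}
     /\ (fun k => (nk k)%:R : R) @ \oo --> +oo
     /\ (forall k, prob_density (f k)
          /\ (forall i : 'I_(nk k), dens_int (f k) (fun x => (tnth x i)%:E) = 0%E)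
          /\ (forall i j : 'I_(nk k),
                dens_int (f k) (fun x => (tnth x i * tnth x j)%:E) = ((i == j)%:R)%:E))
     /\ (exists C : R, 0 < C /\
          \forall k \near \oo,
            (`| lsdeficit (f k) | <= (C * (nk k)%:R `^ (- 3^-1))%:E)%E)
     /\ (exists c : R, 0 < c /\
          \forall k \near \oo,
            ((c * (nk k)%:R `^ (6^-1))%:E <=
              ereal_inf [set wasserstein 2 (dens_meas (f k)) (gaussian m)
                        | m in [set: (nk k).-tuple R]])%E)).
Proof.
split.
- exists density1; split; [|split].
  + move=> k; have [p0 p1 _] := @weight1 R k; split; first exact: prob_density_tensor.
    exists (k.+2%:R ^- 2), [tuple (1 - k.+2%:R ^- 2) * k.+2%:R ^+ 3],
      [tuple - k.+2%:R ^- 2 * k.+2%:R ^+ 3].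
    split; first by rewrite !ltW.
    by move=> A mA; exact: dens_meas_mixture1.
  + have /choice[D DP] := @density1_deficit R.
    rewrite (_ : (fun k => _) = fun k => (D k)%:E); last first.
      by apply/funext => k; have [-> _] := DP k.
    apply: cvg_EFin; first exact: nearW.
    apply/norm_cvg0P; apply: (@squeeze_cvgr _ _ _ _ (fun=> 0) (fun k => 5 * @harmonic R k)).
    * apply: nearW => k; rewrite normr_ge0/= (le_trans (DP k).2)// ler_pM2l//.
      by rewrite lef_pV2 ?posrE// ler_nat.
    * exact: cvg_cst.
    * by rewrite -[X in _ --> X](mulr0 5); apply: cvgMr; exact: cvg_harmonic.
  + apply/cvgeyPge => A; near=> k.
    apply: le_ereal_inf_tmp => _ [m _ <-]; apply: le_trans (density1_wasserstein k m).
    (* Exactly the threshold beyond which [N / 2 - 2 e^(1/2)] exceeds [A]. *)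
    have : 2 * A + 4 * expR 2^-1 <= k%:R by near: k; exact: nbhs_infty_ger.
    have : k%:R <= k.+2%:R :> R by rewrite ler_nat ltnW.
    by rewrite lee_fin; lra.
- exists (fun k => k.+2 ^ 6)%N, density6; split; [|split; [|split; [|split]]].
  + by move=> a b ab; rewrite leq_exp2r.
  + apply/cvgryPge => A; near=> k.
    have kA : A <= k%:R by near: k; exact: nbhs_infty_ger.
    apply: le_trans kA _; rewrite ler_nat.
    by rewrite (leq_trans (leq_trans (leqnSn _) (leqnSn _)))// -{1}[k.+2]expn1 leq_pexp2l.
  + exact: density6_isotropic.
  (* For [n = N^6], the power [n^(-1/3)] is [N^-2], so the constant is that of
     [density6_deficit]. *)
  + exists 8; split => //; apply: nearW => k.
    rewrite natrX -powR_mulrn// -powRrM (_ : 6%:R * - 3^-1 = - 2%:R); last by field.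
    by rewrite powR_invn//; exact: density6_deficit.
  (* Here [n^(1/6) = N], and the bound [N / 8] is available once [N >= 1024 e^(1/2)]. *)
  + exists 8^-1; split; first by rewrite invr_gt0.
    near=> k; apply: le_ereal_inf_tmp => _ [m _ <-].
    rewrite natrX -powR_mulrn// -powRrM divff// powRr1// mulrC.
    apply: density6_wasserstein.
    apply: (@le_trans _ _ k%:R); last by rewrite ler_nat ltnW.
    by near: k; exact: nbhs_infty_ger.
Unshelve. all: by end_near. Qed.
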